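(* Let $b$ be complex, $z\neq0$ complex and $x>0$ real. Then $$\frac{z^{x}}{\Gamma(b+x)}=-\int_{x}^{\infty}\gamma_{-1}\left(\left[\frac{a}{x}\right]\right)\frac{d}{da}E_{a,b}\left(z^{a}\right)da$$ and $$\frac{2z^{2x}}{\Gamma(b+2x)}-\frac{z^{x}}{\Gamma(b+x)}=-\int_{x}^{\infty}\gamma_{-1}\left(\left[\frac{a}{x}\right]\right)\frac{d}{da}E_{a,b}\left(-z^{a}\right)da .$$
   Context: The Mittag-Leffler function is $E_{a,b}(z)=\sum_{k=0}^{\infty}\frac{z^{k}}{\Gamma(b+ak)}$ for $\operatorname{Re}(a)>0$, with $1/\Gamma$ the entire reciprocal Gamma function. $\gamma_{-1}(k)=\sum_{l=1}^{k}\mu(l)$ is the Mertens function, where $\mu$ is the Möbius function; $[y]$ is the largest integer not exceeding $y$. Powers are $z^{c}=e^{c\log z}$ with the same fixed value of $\log z$ throughout, $-z^{a}$ means $-(z^{a})$, and $\frac{d}{da}E_{a,b}(\pm z^{a})$ is the total derivative of the function $a\mapsto E_{a,b}(\pm z^{a})$ on $(0,\infty)$. *)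

(* Defs.v *)
From Stdlib Require Import Reals ZArith.
From Coquelicot Require Import Coquelicot.
From mathcomp Require prime.

Open Scope C_scope.

Definition Cexp (w : C) : C :=
  (exp (Re w) * cos (Im w), exp (Re w) * sin (Im w))%R.

(* z ^ c for the determination logz of the logarithm of z *)
Definition Cpower (logz c : C) : C := Cexp (c * logz).

(* s (s + 1) ... (s + n - 1) *)
Fixpoint rising (s : C) (n : nat) : C :=
  match n with
  | O => 1
  | S m => rising s m * (s + INR m)
  end.

(* 1 / Gamma by Gauss's product formula
     1 / Gamma(s) = lim_n s (s + 1) ... (s + n) / (n! n^s),
   whose limit exists for every complex s; it is 0 at s = 0, -1, -2, ... *)
Definition recip_Gamma (s : C) : C :=
  iota (T := C_R_CompleteNormedModule)
    (fun l => filterlim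
       (fun n : nat => rising s (S n) / (INR (fact n) * Cexp (s * ln (INR n))))
       eventually (locally l)).

Definition mittag_leffler (a b z : C) : C :=
  iota (T := C_R_CompleteNormedModule)
    (is_series (K := R_AbsRing) (V := C_R_NormedModule)
       (fun k : nat => z ^ k * recip_Gamma (b + a * INR k))).

(* Derivative of a complex-valued function of a real variable; like Derive, it
   is meaningful only where ex_derive holds. *)
Definition RC_derive (f : R -> C) (t : R) : C :=
  iota (T := C_R_CompleteNormedModule)
    (is_derive (K := R_AbsRing) (V := C_R_NormedModule) f t).

(* (-1)^r if n > 0 is a product of r distinct primes, and 0 if a square > 1
   divides n; the value at n = 0 is never used. *)
Definition moebius (n : nat) : Z :=
  if seq.all (fun p => Nat.eqb (prime.logn p n) 1) (prime.primes n)
  then ((-1) ^ Z.of_nat (seq.size (prime.primes n)))%Z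
  else 0%Z.

Definition mertens (k : nat) : R :=
  sum_n_m (fun l => IZR (moebius l)) 1 k.

(* The integrand M([a / x]) * f'(a); Int_part is the floor function. *)
Definition mertens_integrand (x : R) (f : R -> C) (a : R) : C :=
  mertens (Z.to_nat (Int_part (a / x))) * RC_derive f a.

(* Main.v *)
Require Import Defs.
From Stdlib Require Import Reals ZArith.
From Coquelicot Require Import Coquelicot.
From Stdlib Require Import Lra Lia Psatz PSeries_reg.
From mathcomp Require ssreflect ssrbool ssrfun eqtype ssrnat seq div prime.

(** Put [h t = z^t / Gamma (b + t)] for real [t >= 0], so that
    [E_{a,b}(z^a) = sum_k h (a k)], with constant term [h 0].  Write
    [T a = E_{a,b}(z^a) - h 0 = sum_(k >= 1) h (a k)].

    The integrand is a constant multiple [M(n)] of the derivative of [T] on each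
    interval from [n x] to [(n + 1) x].  Integrating piece by piece and summing by
    parts, the integral from [x] to [B] is, with [N] the integer part of [B / x],
    [M(N) T(B) - sum_(n <= N) mu(n) T(n x)] (is_RInt_mertens).  Since
    [|M(N)| <= N] and [T] decays, the first term vanishes as [B] tends to infinity.
    In the second one the coefficient of [h (m x)] is the sum of [mu] over the
    divisors of [m] not exceeding [N], so that by Moebius inversion it tends to
    [h x] (moebius_inversion).

    For the second identity, [(-1)^k = 2 [k even] - 1] gives
    [E_{a,b}(-z^a) = 2 E_{2a,b}(z^{2a}) - E_{a,b}(z^a)], and everything is linear:
    the limit is [2 h (2 x) - h x].

    The analytic input is that [h] is continuously differentiable and that [h] and
    its derivative decay like [t^(-4)].  For the first point, consecutive terms of
    Gauss's product have quotients [1 + O(1/n^2)] with derivatives [O(1/n^2)],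
    locally uniformly, which bounds the partial products and their derivatives;
    the product is then a normally convergent series that can be differentiated
    termwise (recip_Gamma_C1).  For the second, the functional equation reads
    [z h(t) = (b + t) h(t + 1)], and can itself be differentiated
    (ml_term_decay).  The same termwise differentiation then applies to
    [sum_k h (a k)] as a function of [a] (ml_sum_C1). *)

Open Scope R_scope.

(** * Complex limits, derivatives and exponentials *)

Notation is_Cderive := (is_derive (K := R_AbsRing) (V := C_R_NormedModule)).
Notation is_Cseries := (is_series (K := R_AbsRing) (V := C_R_NormedModule)).
Notation Clocally := (locally (T := C_R_NormedModule)).

Lemma Cmod_le_Re_Im (w : C) : Cmod w <= Rabs (Re w) + Rabs (Im w).
Proof.
  destruct w as [p q]; unfold Cmod, Re, Im; simpl fst; simpl snd.
  rewrite <- (sqrt_pow2 (Rabs p + Rabs q)).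
  2: generalize (Rabs_pos p) (Rabs_pos q); lra.
  apply sqrt_le_1_alt.
  rewrite <- (pow2_abs p), <- (pow2_abs q).
  generalize (Rabs_pos p) (Rabs_pos q); nra.
Qed.

Lemma im_le_Cmod (w : C) : Rabs (Im w) <= Cmod w.
Proof. eapply Rle_trans; [apply Rmax_r | apply Rmax_Cmod]. Qed.

Lemma Cmod_triangle_minus (u v : C) : Cmod (u - v) <= Cmod u + Cmod v.
Proof. unfold Cminus; rewrite <- (Cmod_opp v); apply Cmod_triangle. Qed.

Lemma filterlim_C_pair {T} (F : (T -> Prop) -> Prop) {FF : Filter F}
  (f : T -> C) (l : C) :
  filterlim (fun t => Re (f t)) F (locally (Re l)) ->
  filterlim (fun t => Im (f t)) F (locally (Im l)) ->
  filterlim f F (Clocally l).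
Proof.
  intros Hr Hi P [e HP].
  assert (H1 := proj1 (filterlim_locally _ _) Hr e).
  assert (H2 := proj1 (filterlim_locally _ _) Hi e).
  unfold filtermap; generalize (filter_and _ _ H1 H2).
  apply filter_imp; intros t [A B]; apply HP; split; assumption.
Qed.

Lemma filterlim_C_Re {T} (F : (T -> Prop) -> Prop) {FF : Filter F}
  (f : T -> C) (l : C) :
  filterlim f F (Clocally l) -> filterlim (fun t => Re (f t)) F (locally (Re l)).
Proof.
  intros H; apply filterlim_locally; intros e.
  generalize (proj1 (filterlim_locally _ _) H e).
  apply filter_imp; intros t [A _]; exact A.
Qed.

Lemma filterlim_C_Im {T} (F : (T -> Prop) -> Prop) {FF : Filter F}
  (f : T -> C) (l : C) :
  filterlim f F (Clocally l) -> filterlim (fun t => Im (f t)) F (locally (Im l)).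
Proof.
  intros H; apply filterlim_locally; intros e.
  generalize (proj1 (filterlim_locally _ _) H e).
  apply filter_imp; intros t [_ A]; exact A.
Qed.

Lemma filterlim_Cmod {T} (F : (T -> Prop) -> Prop) {FF : Filter F}
  (f : T -> C) (l : C) :
  filterlim f F (Clocally l) <->
  (forall eps, 0 < eps -> F (fun t => Cmod (f t - l) < eps)).
Proof.
  split.
  - intros H e He.
    assert (H' := proj1 (filterlim_locally_ball_norm (K := R_AbsRing)
      (U := C_R_NormedModule) _ _) H (mkposreal e He)).
    revert H'; apply filter_imp; intros t Ht.
    change (norm (V := C_R_NormedModule) (f t - l)%C < e) in Ht; rewrite Cmod_norm; exact Ht.
  - intros H; apply (proj2 (filterlim_locally_ball_norm (K := R_AbsRing)
      (U := C_R_NormedModule) _ _)); intros e.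
    generalize (H e (cond_pos e)); apply filter_imp; intros t Ht.
    unfold ball_norm; change (norm (V := C_R_NormedModule) (f t - l)%C < e).
    rewrite <- Cmod_norm; exact Ht.
Qed.

Lemma filterlim_Cplus {T} (F : (T -> Prop) -> Prop) {FF : Filter F}
  (f g : T -> C) (l m : C) :
  filterlim f F (Clocally l) -> filterlim g F (Clocally m) ->
  filterlim (fun t => f t + g t)%C F (Clocally (l + m)%C).
Proof.
  intros Hf Hg.
  exact (filterlim_comp_2 f g (plus (G := C_R_NormedModule)) Hf Hg (filterlim_plus l m)).
Qed.

Lemma filterlim_Cmult {T} (F : (T -> Prop) -> Prop) {FF : Filter F}
  (f g : T -> C) (l m : C) :
  filterlim f F (Clocally l) -> filterlim g F (Clocally m) ->
  filterlim (fun t => f t * g t)%C F (Clocally (l * m)%C).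
Proof.
  intros Hf Hg.
  assert (fr := filterlim_C_Re _ _ _ Hf). assert (fi := filterlim_C_Im _ _ _ Hf).
  assert (gr := filterlim_C_Re _ _ _ Hg). assert (gi := filterlim_C_Im _ _ _ Hg).
  assert (M : forall (p q : T -> R) (u v : R), filterlim p F (locally u) ->
     filterlim q F (locally v) -> filterlim (fun t => p t * q t) F (locally (u * v))).
  { intros p q u v Hp Hq.
    exact (filterlim_comp_2 p q Rmult Hp Hq (filterlim_mult (K := R_AbsRing) u v)). }
  assert (A : forall (p q : T -> R) (u v : R), filterlim p F (locally u) ->
     filterlim q F (locally v) -> filterlim (fun t => p t + q t) F (locally (u + v))).
  { intros p q u v Hp Hq.
    exact (filterlim_comp_2 p q Rplus Hp Hq (filterlim_plus (V := R_NormedModule) u v)). }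
  assert (N : forall (p : T -> R) (u : R), filterlim p F (locally u) ->
     filterlim (fun t => - p t) F (locally (- u))).
  { intros p u Hp; exact (filterlim_comp _ _ _ _ _ _ _ _ Hp (filterlim_opp (V := R_NormedModule) u)). }
  apply filterlim_C_pair; auto; simpl.
  - apply A; [apply M; assumption | apply N, M; assumption].
  - apply A; apply M; assumption.
Qed.

Lemma RtoC_neq_0 (r : R) : r <> 0 -> RtoC r <> 0%C.
Proof. intros H E; apply H, RtoC_inj, E. Qed.

Lemma Cseq_unique (u : nat -> C) (l m : C) :
  filterlim u eventually (Clocally l) -> filterlim u eventually (Clocally m) -> l = m.
Proof. exact (filterlim_locally_unique (K := R_AbsRing) (V := C_R_NormedModule) u l m). Qed.

Lemma is_Cderive_pair (f : R -> C) (t : R) (l : C) :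
  is_derive (fun s => Re (f s)) t (Re l) ->
  is_derive (fun s => Im (f s)) t (Im l) -> is_Cderive f t l.
Proof.
  intros Hr Hi.
  assert (E : forall w : C,
    plus (scal (Re w) ((1, 0) : C_R_NormedModule)) (scal (Im w) ((0, 1) : C_R_NormedModule)) = w).
  { intros [p q]; unfold plus, scal, Re, Im; cbn; unfold prod_plus, prod_scal, plus, scal; cbn.
    unfold mult; cbn; f_equal; ring. }
  rewrite <- (E l).
  apply (is_derive_ext (fun s => plus (scal (Re (f s)) ((1, 0) : C_R_NormedModule))
                                      (scal (Im (f s)) ((0, 1) : C_R_NormedModule)))).
  { intros s; apply E. }
  apply (is_derive_plus (V := C_R_NormedModule)); apply (is_derive_scal_l (V := C_R_NormedModule)); assumption.
Qed.

Lemma is_Cderive_Re (f : R -> C) (t : R) (l : C) :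
  is_Cderive f t l -> is_derive (fun s => Re (f s)) t (Re l).
Proof.
  intros H.
  apply (filterdiff_comp' (U := R_NormedModule) (V := C_R_NormedModule) (W := R_NormedModule)
    f (fun w => fst w) t (fun y => scal y l) (fun w => fst w)).
  - exact H.
  - apply filterdiff_linear, is_linear_fst.
Qed.

Lemma is_Cderive_Im (f : R -> C) (t : R) (l : C) :
  is_Cderive f t l -> is_derive (fun s => Im (f s)) t (Im l).
Proof.
  intros H.
  apply (filterdiff_comp' (U := R_NormedModule) (V := C_R_NormedModule) (W := R_NormedModule)
    f (fun w => snd w) t (fun y => scal y l) (fun w => snd w)).
  - exact H.
  - apply filterdiff_linear, is_linear_snd.
Qed.

Lemma is_Cderive_unique (f : R -> C) (t : R) (l m : C) :
  is_Cderive f t l -> is_Cderive f t m -> l = m.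
Proof.
  intros Hl Hm.
  apply injective_projections; [change (Re l = Re m) | change (Im l = Im m)].
  - rewrite <- (is_derive_unique _ _ _ (is_Cderive_Re _ _ _ Hl)).
    exact (is_derive_unique _ _ _ (is_Cderive_Re _ _ _ Hm)).
  - rewrite <- (is_derive_unique _ _ _ (is_Cderive_Im _ _ _ Hl)).
    exact (is_derive_unique _ _ _ (is_Cderive_Im _ _ _ Hm)).
Qed.

Lemma RC_derive_eq (f : R -> C) (t : R) (l : C) :
  is_Cderive f t l -> RC_derive f t = l.
Proof.
  intros H; unfold RC_derive.
  apply (iota_unique (V := C_R_CompleteNormedModule)).
  - intros m Hm; exact (is_Cderive_unique _ _ _ _ Hm H).
  - exact H.
Qed.

Lemma is_Cderive_ext (f g : R -> C) (t : R) (l : C) :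
  (forall s, f s = g s) -> is_Cderive f t l -> is_Cderive g t l.
Proof. exact (is_derive_ext (V := C_R_NormedModule) f g t l). Qed.

Lemma is_Cderive_ext_pos (f g : R -> C) (t : R) (l : C) : 0 < t ->
  (forall s, 0 < s -> f s = g s) -> is_Cderive f t l -> is_Cderive g t l.
Proof.
  intros Ht H; apply (is_derive_ext_loc (V := C_R_NormedModule)).
  exists (mkposreal t Ht); intros s Hs; apply H.
  unfold ball in Hs; simpl in Hs; unfold AbsRing_ball, abs, minus, plus, opp in Hs; simpl in Hs.
  apply Rabs_def2 in Hs; lra.
Qed.

Lemma is_Cderive_plus (f g : R -> C) (t : R) (l m : C) :
  is_Cderive f t l -> is_Cderive g t m ->
  is_Cderive (fun s => f s + g s)%C t (l + m)%C.
Proof. exact (is_derive_plus (V := C_R_NormedModule) f g t l m). Qed.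

Lemma is_Cderive_const (w : C) (t : R) : is_Cderive (fun _ => w) t (RtoC 0).
Proof. exact (is_derive_const (V := C_R_NormedModule) w t). Qed.

Lemma is_Cderive_mult (f g : R -> C) (t : R) (l m : C) :
  is_Cderive f t l -> is_Cderive g t m ->
  is_Cderive (fun s => f s * g s)%C t (l * g t + f t * m)%C.
Proof.
  intros Hf Hg.
  assert (fr := is_Cderive_Re _ _ _ Hf). assert (fi := is_Cderive_Im _ _ _ Hf).
  assert (gr := is_Cderive_Re _ _ _ Hg). assert (gi := is_Cderive_Im _ _ _ Hg).
  assert (M : forall (p q : R -> R) dp dq, is_derive p t dp -> is_derive q t dq ->
     is_derive (fun s => p s * q s) t (dp * q t + p t * dq)).
  { intros p q dp dq Hp Hq; apply (is_derive_mult (K := R_AbsRing)); auto.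
    intros; apply Rmult_comm. }
  apply is_Cderive_pair.
  - replace (Re (l * g t + f t * m)%C) with
      ((Re l * Re (g t) + Re (f t) * Re m) - (Im l * Im (g t) + Im (f t) * Im m)).
    + apply (is_derive_minus (K := R_AbsRing) (V := R_NormedModule)); apply M; assumption.
    + unfold Re, Im; simpl; ring.
  - replace (Im (l * g t + f t * m)%C) with
      ((Re l * Im (g t) + Re (f t) * Im m) + (Im l * Re (g t) + Im (f t) * Re m)).
    + apply (is_derive_plus (K := R_AbsRing) (V := R_NormedModule)); apply M; assumption.
    + unfold Re, Im; simpl; ring.
Qed.

Lemma is_Cderive_affine (p q : C) (t : R) :
  is_Cderive (fun s : R => p + s * q)%C t q.
Proof.
  apply is_Cderive_pair; unfold Re, Im; simpl; auto_derive; auto; ring.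
Qed.

Lemma is_Cderive_Cexp (p q : C) (t : R) :
  is_Cderive (fun s : R => Cexp (p + s * q))%C t (q * Cexp (p + t * q))%C.
Proof.
  apply is_Cderive_pair; unfold Cexp, Re, Im; simpl; unfold Rminus; auto_derive; auto; ring.
Qed.

Lemma is_Cderive_rescale (f : R -> C) (c t : R) (l : C) :
  is_Cderive f (c * t) l -> is_Cderive (fun s => f (c * s)) t (c * l)%C.
Proof.
  intros H.
  replace (c * l)%C with (scal (V := C_R_NormedModule) c l).
  - apply (is_derive_comp (V := C_R_NormedModule) f (fun s => c * s)); [exact H|].
    auto_derive; auto; ring.
  - destruct l as [p q]; unfold scal; simpl; unfold prod_scal, scal; simpl; unfold mult; simpl.
    unfold Cmult; simpl; f_equal; ring.
Qed.

Lemma Cexp_0 : Cexp 0%C = 1%C.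
Proof.
  unfold Cexp; simpl; rewrite exp_0, cos_0, sin_0.
  apply injective_projections; simpl; ring.
Qed.

Lemma Cexp_plus (u v : C) : Cexp (u + v)%C = (Cexp u * Cexp v)%C.
Proof.
  unfold Cexp, Re, Im; destruct u as [p q], v as [r s]; simpl.
  rewrite exp_plus, cos_plus, sin_plus.
  apply injective_projections; simpl; ring.
Qed.

Lemma Cmod_Cexp (u : C) : Cmod (Cexp u) = exp (Re u).
Proof.
  unfold Cexp, Cmod; simpl fst; simpl snd.
  replace ((exp (Re u) * cos (Im u)) ^ 2 + (exp (Re u) * sin (Im u)) ^ 2)
    with (exp (Re u) ^ 2 * (Rsqr (sin (Im u)) + Rsqr (cos (Im u)))) by (unfold Rsqr; ring).
  rewrite sin2_cos2, Rmult_1_r.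
  apply sqrt_pow2, Rlt_le, exp_pos.
Qed.

Lemma Cexp_neq_0 (u : C) : Cexp u <> 0%C.
Proof.
  intros H; apply (Rlt_irrefl 0).
  rewrite <- Cmod_0 at 2; rewrite <- H, Cmod_Cexp; apply exp_pos.
Qed.

Lemma Cexp_opp (u : C) : Cexp (- u)%C = (/ Cexp u)%C.
Proof.
  assert (H : (Cexp u * Cexp (- u))%C = 1%C).
  { rewrite <- Cexp_plus. replace (u + - u)%C with (RtoC 0) by ring. apply Cexp_0. }
  generalize (Cexp_neq_0 u); intros N.
  replace (Cexp (- u)%C) with (/ Cexp u * (Cexp u * Cexp (- u)))%C by (field; exact N).
  rewrite H; ring.
Qed.

Lemma Cexp_pow (u : C) (k : nat) : Cexp (u * INR k)%C = (Cexp u ^ k)%C.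
Proof.
  induction k as [|k IH].
  - simpl; rewrite <- Cexp_0; f_equal; simpl; ring.
  - rewrite S_INR; simpl; rewrite <- IH, <- Cexp_plus; f_equal.
    rewrite RtoC_plus; ring.
Qed.

Lemma Cexp_ln (y : R) : 0 < y -> Cexp (ln y) = y.
Proof.
  intros H; unfold Cexp; simpl; rewrite exp_ln, cos_0, sin_0 by exact H.
  apply injective_projections; simpl; ring.
Qed.

Lemma is_Cderive_Cexp_linear (q : C) (t : R) :
  is_Cderive (fun s : R => Cexp (s * q)) t (q * Cexp (t * q))%C.
Proof.
  apply (is_Cderive_ext (fun s : R => Cexp (0 + s * q))%C).
  - intros s; f_equal; ring.
  - replace (t * q)%C with (0 + t * q)%C by ring; apply is_Cderive_Cexp.
Qed.

(** The mean value inequality for the real and imaginary parts separately, whence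
    the factor 2. *)
Lemma Cmod_increment_le (f df : R -> C) (D : R) :
  (forall t, 0 <= t <= 1 -> is_Cderive f t (df t) /\ Cmod (df t) <= D) ->
  Cmod (f 1 - f 0)%C <= 2 * D.
Proof.
  intros H.
  assert (HA : forall t, Rabs (t - 1 / 2) <= 1 / 2 -> 0 <= t <= 1).
  { intros t; unfold Rabs; destruct (Rcase_abs _); lra. }
  assert (G : forall g dg : R -> R,
    (forall t, 0 <= t <= 1 -> is_derive g t (dg t) /\ Rabs (dg t) <= D) ->
    Rabs (g 1 - g 0) <= D).
  { intros g dg Hg.
    (* Both ends are compared with the midpoint: the bound on the derivative is
       then needed in the interval only. *)
    assert (M1 := bounded_variation g dg D (1 / 2) 1).
    assert (M0 := bounded_variation g dg D (1 / 2) 0).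
    replace (Rabs (1 - 1 / 2)) with (1 / 2) in M1 by (rewrite Rabs_pos_eq; lra).
    replace (Rabs (0 - 1 / 2)) with (1 / 2) in M0 by (rewrite Rabs_left; lra).
    specialize (M1 (fun t Ht => Hg t (HA t Ht))).
    specialize (M0 (fun t Ht => Hg t (HA t Ht))).
    replace (g 1 - g 0) with ((g 1 - g (1 / 2)) - (g 0 - g (1 / 2))) by ring.
    eapply Rle_trans; [apply Rabs_triang|]; rewrite Rabs_Ropp; lra. }
  eapply Rle_trans; [apply Cmod_le_Re_Im|].
  assert (R1 : Rabs (Re (f 1) - Re (f 0)) <= D).
  { apply (G (fun t => Re (f t)) (fun t => Re (df t))); intros t Ht; destruct (H t Ht) as [A B]; split.
    - apply is_Cderive_Re, A.
    - eapply Rle_trans; [apply re_le_Cmod | exact B]. }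
  assert (I1 : Rabs (Im (f 1) - Im (f 0)) <= D).
  { apply (G (fun t => Im (f t)) (fun t => Im (df t))); intros t Ht; destruct (H t Ht) as [A B]; split.
    - apply is_Cderive_Im, A.
    - eapply Rle_trans; [apply im_le_Cmod | exact B]. }
  replace (Re (f 1 - f 0)%C) with (Re (f 1) - Re (f 0)) by (unfold Re; simpl; ring).
  replace (Im (f 1 - f 0)%C) with (Im (f 1) - Im (f 0)) by (unfold Im; simpl; ring).
  lra.
Qed.

Notation Ccontinuous := (continuous (T := R_UniformSpace) (U := C_R_NormedModule)).

Lemma Ccontinuous_pair (f : R -> C) (t : R) :
  continuous (fun s => Re (f s)) t -> continuous (fun s => Im (f s)) t -> Ccontinuous f t.
Proof. intros; apply filterlim_C_pair; assumption || apply locally_filter. Qed.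

Lemma is_Cderive_continuous (f : R -> C) (t : R) (l : C) :
  is_Cderive f t l -> Ccontinuous f t.
Proof. intros H; apply (ex_derive_continuous (V := C_R_NormedModule)); exists l; exact H. Qed.

Lemma Ccontinuous_Re (f : R -> C) (t : R) :
  Ccontinuous f t -> continuous (fun s => Re (f s)) t.
Proof. apply filterlim_C_Re, locally_filter. Qed.

Lemma Ccontinuous_Im (f : R -> C) (t : R) :
  Ccontinuous f t -> continuous (fun s => Im (f s)) t.
Proof. apply filterlim_C_Im, locally_filter. Qed.

Lemma Ccontinuous_mult (f g : R -> C) (t : R) :
  Ccontinuous f t -> Ccontinuous g t -> Ccontinuous (fun s => f s * g s)%C t.
Proof. apply filterlim_Cmult, locally_filter. Qed.

Lemma Ccontinuous_plus (f g : R -> C) (t : R) :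
  Ccontinuous f t -> Ccontinuous g t -> Ccontinuous (fun s => f s + g s)%C t.
Proof. apply filterlim_Cplus, locally_filter. Qed.

Lemma Ccontinuous_const (p : C) (t : R) : Ccontinuous (fun _ => p) t.
Proof. apply continuous_const. Qed.

Lemma Ccontinuous_ext (f g : R -> C) (t : R) :
  (forall s, f s = g s) -> Ccontinuous f t -> Ccontinuous g t.
Proof. apply (continuous_ext (T := R_UniformSpace) (U := C_R_NormedModule)). Qed.

Lemma Ccontinuous_affine (p q : C) (t : R) : Ccontinuous (fun s : R => p + s * q)%C t.
Proof. eapply is_Cderive_continuous, is_Cderive_affine. Qed.

Lemma continuous_Cmod (f : R -> C) (t : R) :
  Ccontinuous f t -> continuous (fun s => Cmod (f s)) t.
Proof.
  intros H.
  apply (continuous_ext (fun s => norm (V := C_R_NormedModule) (f s))).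
  - intros s; symmetry; apply Cmod_norm.
  - apply (continuous_comp f (fun w => norm (V := C_R_NormedModule) w)); [exact H|].
    apply (filterlim_norm (V := C_R_NormedModule)).
Qed.

(** * Normally convergent series *)

Lemma series_tail_le (a m : nat -> R) (n : nat) :
  (forall k, Rabs (a k) <= m k) -> ex_series m ->
  Rabs (Series a - sum_n a n) <= Series m - sum_n m n.
Proof.
  intros H Hm.
  assert (Ha : ex_series (fun k => Rabs (a k))).
  { apply (ex_series_le (K := R_AbsRing) (V := R_CompleteNormedModule)) with m; auto.
    intros k; unfold norm; simpl; unfold abs; simpl; rewrite Rabs_Rabsolu; apply H. }
  rewrite (Series_incr_n a (S n)), (Series_incr_n m (S n)); auto; try lia.
  2: apply ex_series_Rabs, Ha.
  rewrite !sum_n_Reals; simpl pred.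
  match goal with |- Rabs ?u <= ?v =>
    replace u with (Series (fun k => a (S n + k)%nat)) by ring;
    replace v with (Series (fun k => m (S n + k)%nat)) by ring end.
  eapply Rle_trans; [apply Series_Rabs|apply Series_le].
  - apply (ex_series_incr_n (fun k => Rabs (a k))), Ha.
  - intros k; split; [apply Rabs_pos | apply H].
  - apply (ex_series_incr_n m), Hm.
Qed.

(** Weierstrass's test. *)
Lemma series_CVU (f : nat -> R -> R) (m : nat -> R) (c : R) (r : posreal) :
  (forall n y, Boule c r y -> Rabs (f n y) <= m n) -> ex_series m ->
  CVU (fun n y => sum_n (fun k => f k y) n) (fun y => Series (fun n => f n y)) c r.
Proof.
  intros H Hm e He.
  destruct (proj1 (filterlim_locally _ _) (Series_correct _ Hm) (mkposreal e He)) as [N HN].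
  exists N; intros n y Hn Hy.
  eapply Rle_lt_trans.
  - apply (series_tail_le _ m); auto.
  - generalize (HN n Hn); unfold ball; simpl; unfold AbsRing_ball, abs, minus, plus, opp; simpl.
    intros B; eapply Rle_lt_trans; [apply Rle_abs|]; rewrite Rabs_minus_sym; exact B.
Qed.

Lemma Series_derive (f f' : nat -> R -> R) (m : nat -> R) (c : R) (r : posreal) :
  (forall n y, Boule c r y -> is_derive (f n) y (f' n y)) ->
  (forall n y, Boule c r y -> continuous (f' n) y) ->
  (forall n y, Boule c r y -> Rabs (f n y) <= m n) ->
  (forall n y, Boule c r y -> Rabs (f' n y) <= m n) ->
  ex_series m ->
  forall y, Boule c r y ->
    is_derive (fun t => Series (fun n => f n t)) y (Series (fun n => f' n y)) /\
    continuous (fun t => Series (fun n => f' n t)) y.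
Proof.
  intros Hd Hc Hf Hf' Hm y Hy.
  assert (U := series_CVU f m c r Hf Hm).
  assert (U' := series_CVU f' m c r Hf' Hm).
  split.
  - apply is_derive_Reals.
    apply (CVU_derivable (fun n t => sum_n (fun k => f k t) n) (fun n t => sum_n (fun k => f' k t) n)
      (fun t => Series (fun n => f n t)) (fun t => Series (fun n => f' n t)) c r); auto.
    + intros t Ht e He; destruct (U e He) as [N HN]; exists N; intros n Hn.
      unfold Rdist; rewrite Rabs_minus_sym; apply HN; auto.
    + intros n t Ht; apply is_derive_Reals.
      apply (is_derive_sum_n (V := R_NormedModule)); intros k _; apply Hd, Ht.
  - apply continuity_pt_filterlim.
    apply (CVU_continuity _ _ _ _ U'); auto.
    intros n t Ht; apply continuity_pt_filterlim.
    induction n as [|n IH].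
    + apply (continuous_ext (f' 0%nat)); [intros s; now rewrite sum_O | apply Hc, Ht].
    + apply (continuous_ext (fun s => plus (sum_n (fun k => f' k s) n) (f' (S n) s))).
      { intros s; now rewrite sum_Sn. }
      apply (continuous_plus (V := R_NormedModule)); [exact IH | apply Hc, Ht].
Qed.

(** Built from the two real series, so that real termwise differentiation applies
    to each. *)
Definition CSeries (u : nat -> C) : C :=
  (Series (fun n => Re (u n)), Series (fun n => Im (u n))).

Lemma Re_sum_n (u : nat -> C) (n : nat) :
  Re (sum_n (G := C_R_NormedModule) u n) = sum_n (fun k => Re (u k)) n.
Proof.
  induction n as [|n IH]; [now rewrite !sum_O|].
  rewrite !sum_Sn, <- IH; reflexivity.
Qed.

Lemma Im_sum_n (u : nat -> C) (n : nat) :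
  Im (sum_n (G := C_R_NormedModule) u n) = sum_n (fun k => Im (u k)) n.
Proof.
  induction n as [|n IH]; [now rewrite !sum_O|].
  rewrite !sum_Sn, <- IH; reflexivity.
Qed.

Lemma ex_series_dominated (a m : nat -> R) :
  (forall k, Rabs (a k) <= m k) -> ex_series m -> ex_series a.
Proof. intros H; apply (ex_series_le (K := R_AbsRing) (V := R_CompleteNormedModule)); exact H. Qed.

Lemma CSeries_correct (u : nat -> C) (m : nat -> R) :
  (forall k, Cmod (u k) <= m k) -> ex_series m -> is_Cseries u (CSeries u).
Proof.
  intros H Hm; apply filterlim_C_pair; try apply eventually_filter; simpl.
  - apply (filterlim_ext (sum_n (fun k => Re (u k)))); [intros n; symmetry; apply Re_sum_n|].
    apply Series_correct, (ex_series_dominated _ m); auto.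
    intros k; eapply Rle_trans; [apply re_le_Cmod | apply H].
  - apply (filterlim_ext (sum_n (fun k => Im (u k)))); [intros n; symmetry; apply Im_sum_n|].
    apply Series_correct, (ex_series_dominated _ m); auto.
    intros k; eapply Rle_trans; [apply im_le_Cmod | apply H].
Qed.

Lemma is_Cseries_unique (u : nat -> C) (l l' : C) :
  is_Cseries u l -> is_Cseries u l' -> l = l'.
Proof. apply Cseq_unique. Qed.

Lemma Rabs_Series_le (a m : nat -> R) :
  (forall k, Rabs (a k) <= m k) -> ex_series m -> Rabs (Series a) <= Series m.
Proof.
  intros H Hm.
  assert (Ha : ex_series (fun k => Rabs (a k))).
  { apply (ex_series_dominated _ m); auto; intros; rewrite Rabs_Rabsolu; apply H. }
  eapply Rle_trans; [apply Series_Rabs, Ha|apply Series_le; auto].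
  intros k; split; [apply Rabs_pos | apply H].
Qed.

Lemma Cmod_CSeries_le (u : nat -> C) (m : nat -> R) :
  (forall k, Cmod (u k) <= m k) -> ex_series m -> Cmod (CSeries u) <= 2 * Series m.
Proof.
  intros H Hm; eapply Rle_trans; [apply Cmod_le_Re_Im|]; simpl.
  assert (A := Rabs_Series_le (fun k => Re (u k)) m
    (fun k => Rle_trans _ _ _ (re_le_Cmod _) (H k)) Hm).
  assert (B := Rabs_Series_le (fun k => Im (u k)) m
    (fun k => Rle_trans _ _ _ (im_le_Cmod _) (H k)) Hm).
  lra.
Qed.

Lemma CSeries_derive (f f' : nat -> R -> C) (m : nat -> R) (c : R) (r : posreal) :
  (forall n y, Boule c r y -> is_Cderive (f n) y (f' n y)) ->
  (forall n y, Boule c r y -> Ccontinuous (f' n) y) ->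
  (forall n y, Boule c r y -> Cmod (f n y) <= m n) ->
  (forall n y, Boule c r y -> Cmod (f' n y) <= m n) ->
  ex_series m ->
  forall y, Boule c r y ->
    is_Cderive (fun t => CSeries (fun n => f n t)) y (CSeries (fun n => f' n y)) /\
    Ccontinuous (fun t => CSeries (fun n => f' n t)) y.
Proof.
  intros Hd Hc Hf Hf' Hm y Hy.
  destruct (Series_derive (fun n t => Re (f n t)) (fun n t => Re (f' n t)) m c r) with y as [R1 R2]; auto.
  { intros; apply is_Cderive_Re; auto. }
  { intros; apply Ccontinuous_Re; auto. }
  { intros; eapply Rle_trans; [apply re_le_Cmod | auto]. }
  { intros; eapply Rle_trans; [apply re_le_Cmod | auto]. }
  destruct (Series_derive (fun n t => Im (f n t)) (fun n t => Im (f' n t)) m c r) with y as [I1 I2]; auto.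
  { intros; apply is_Cderive_Im; auto. }
  { intros; apply Ccontinuous_Im; auto. }
  { intros; eapply Rle_trans; [apply im_le_Cmod | auto]. }
  { intros; eapply Rle_trans; [apply im_le_Cmod | auto]. }
  split; [apply is_Cderive_pair | apply Ccontinuous_pair]; assumption.
Qed.

Lemma ex_series_inv_sqr : ex_series (fun n => / INR (S n) ^ 2).
Proof.
  (* 1 / (n + 1)^2 <= 2 / ((n + 1) (n + 2)), and the right side telescopes *)
  assert (P : forall n, 0 < INR (S n)) by (intros; apply lt_0_INR; lia).
  apply (ex_series_dominated _ (fun n => 2 * (/ INR (S n) - / INR (S (S n))))).
  - intros n; specialize (P n); rewrite Rabs_pos_eq.
    2: apply Rlt_le, Rinv_0_lt_compat, pow_lt, P.
    rewrite (S_INR (S n)).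
    assert (1 <= INR (S n)) by (apply (le_INR 1); lia).
    replace (2 * (/ INR (S n) - / (INR (S n) + 1))) with (/ (INR (S n) * ((INR (S n) + 1) / 2)))
      by (field; lra).
    apply Rinv_le_contravar; nra.
  - exists (2 * 1).
    apply (is_series_scal_l (K := R_AbsRing) (V := R_NormedModule) 2).
    change (is_lim_seq (sum_n (fun n => / INR (S n) - / INR (S (S n)))) 1).
    apply (is_lim_seq_ext (fun n => 1 - / INR (S (S n)))).
    + induction n as [|n IH]; [rewrite sum_O; simpl; field|].
      rewrite sum_Sn, <- IH; 
      change (1 - / INR (S (S (S n))) =
        (1 - / INR (S (S n))) + (/ INR (S (S n)) - / INR (S (S (S n))))).
      ring.
    + evar_last; [|apply f_equal, (Rminus_0_r 1)].
      apply is_lim_seq_minus'; [apply is_lim_seq_const|].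
      apply (is_lim_seq_incr_1 (fun n => / INR (S n))), (is_lim_seq_incr_1 (fun n => / INR n)).
      change (Finite 0) with (Rbar_inv p_infty).
      apply is_lim_seq_inv; [apply is_lim_seq_INR | discriminate].
Qed.

Lemma is_Cseries_plus (u v : nat -> C) (l m : C) :
  is_Cseries u l -> is_Cseries v m -> is_Cseries (fun k => u k + v k)%C (l + m)%C.
Proof. exact (is_series_plus (V := C_R_NormedModule) u v l m). Qed.

Lemma is_Cseries_ext (u v : nat -> C) (l : C) :
  (forall k, u k = v k) -> is_Cseries u l -> is_Cseries v l.
Proof. exact (is_series_ext (V := C_R_NormedModule) u v l). Qed.

Lemma scal_C (c : R) (w : C) : scal (V := C_R_NormedModule) c w = (c * w)%C.
Proof.
  unfold scal; simpl; unfold prod_scal, scal; simpl; unfold mult; simpl.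
  apply injective_projections; simpl; ring.
Qed.

Lemma is_Cseries_scal (c : R) (u : nat -> C) (l : C) :
  is_Cseries u l -> is_Cseries (fun k => c * u k)%C (c * l)%C.
Proof.
  intros H; rewrite <- scal_C.
  apply (is_Cseries_ext (fun k => scal (V := C_R_NormedModule) c (u k))).
  - intros k; apply scal_C.
  - apply (is_series_scal (V := C_R_NormedModule)), H.
Qed.

(** * Gauss's product for the reciprocal Gamma function *)

Definition gauss (s : C) (n : nat) : C :=
  (rising s (S n) / (INR (fact n) * Cexp (s * ln (INR n))))%C.

Definition log_ratio (n : nat) : R := ln (INR (S n)) - ln (INR (S (S n))).

(** The quotient of consecutive terms of [gauss] is [1 + gauss_incr]. *)
Definition gauss_incr (n : nat) (s : C) : C :=
  ((1 + s * (/ INR (S (S n)))%R) * Cexp (s * log_ratio n) - 1)%C.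

Definition gauss_incr' (n : nat) (s : C) : C :=
  (Cexp (s * log_ratio n) *
   ((/ INR (S (S n)) + log_ratio n)%R + s * (log_ratio n * / INR (S (S n)))%R))%C.

Fixpoint gauss_prod (n : nat) (s : C) : C :=
  match n with
  | O => s * (s + 1)
  | S m => gauss_prod m s * (1 + gauss_incr m s)
  end%C.

Fixpoint gauss_prod' (n : nat) (s : C) : C :=
  match n with
  | O => 2 * s + 1
  | S m => gauss_prod' m s * (1 + gauss_incr m s) + gauss_prod m s * gauss_incr' m s
  end%C.

(** The shift by one starts the recursion at [n = 1], where [ln n] is meaningful. *)
Lemma gauss_eq_prod (s : C) (n : nat) : gauss s (S n) = gauss_prod n s.
Proof.
  induction n as [|n IH].
  - unfold gauss; simpl. rewrite ln_1.
    replace (s * 0)%C with (RtoC 0) by ring; rewrite Cexp_0.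
    field; apply RtoC_neq_0; lra.
  - change (gauss_prod (S n) s) with (gauss_prod n s * (1 + gauss_incr n s))%C.
    rewrite <- IH; unfold gauss, gauss_incr, log_ratio.
    change (rising s (S (S (S n)))) with (rising s (S (S n)) * (s + INR (S (S n))))%C.
    replace (fact (S (S n))) with (S (S n) * fact (S n))%nat by reflexivity.
    rewrite mult_INR, RtoC_mult, RtoC_minus.
    replace (s * (ln (INR (S n)) - ln (INR (S (S n)))))%C
      with (s * ln (INR (S n)) + - (s * ln (INR (S (S n)))))%C by ring.
    rewrite Cexp_plus, Cexp_opp.
    rewrite RtoC_inv by (apply not_0_INR; lia).
    field; repeat split; try apply Cexp_neq_0.
    + apply RtoC_neq_0, not_0_INR; lia.
    + apply RtoC_neq_0, not_0_INR, fact_neq_0.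
Qed.

Lemma ln_le_pred (y : R) : 0 < y -> ln y <= y - 1.
Proof.
  intros H; rewrite <- (ln_exp (y - 1)); apply ln_le; [exact H|].
  generalize (exp_ineq1_le (y - 1)); lra.
Qed.

(** Apply [ln y <= y - 1] to the ratio of [n + 1] and [n + 2] and to its inverse. *)
Lemma log_ratio_bounds (n : nat) :
  - / INR (S n) <= log_ratio n <= - / INR (S (S n)).
Proof.
  unfold log_ratio.
  assert (P : 0 < INR (S n)) by (apply lt_0_INR; lia).
  rewrite (S_INR (S n)).
  assert (A := ln_le_pred ((INR (S n) + 1) / INR (S n)) ltac:(apply Rdiv_lt_0_compat; lra)).
  assert (B := ln_le_pred (INR (S n) / (INR (S n) + 1)) ltac:(apply Rdiv_lt_0_compat; lra)).
  rewrite ln_div in A, B by lra.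
  replace ((INR (S n) + 1) / INR (S n) - 1) with (/ INR (S n)) in A by (field; lra).
  replace (INR (S n) / (INR (S n) + 1) - 1) with (- / (INR (S n) + 1)) in B by (field; lra).
  lra.
Qed.

(** Numerators of the bounds [O(1/n^2)], on the disc of radius [r], for [gauss_incr]
    (the summand with [2 r]) and for its derivative (the summand with 1). *)
Definition incr_const (r : R) : R := (1 + 2 * r) * (exp r * (1 + r)).

(** The terms [1 / (n + 2)] and [ln ((n + 1) / (n + 2))] of [gauss_incr'] cancel up
    to order [1/n^2]. *)
Lemma Cmod_gauss_incr'_le (n : nat) (s : C) (r : R) :
  Cmod s <= r -> Cmod (gauss_incr' n s) <= exp r * (1 + r) / INR (S n) ^ 2.
Proof.
  intros Hs.
  assert (r0 : 0 <= r) by (generalize (Cmod_ge_0 s); lra).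
  assert (P : 1 <= INR (S n)) by (apply (le_INR 1); lia).
  destruct (log_ratio_bounds n) as [L1 L2].
  rewrite (S_INR (S n)) in L2.
  set (i := / INR (S n)) in *.
  assert (i0 : 0 < i) by (apply Rinv_0_lt_compat; lra).
  assert (i1 : i <= 1) by (unfold i; rewrite <- Rinv_1; apply Rinv_le_contravar; lra).
  set (j := / (INR (S n) + 1)) in *.
  assert (j0 : 0 < j) by (apply Rinv_0_lt_compat; lra).
  assert (ji : j <= i) by (apply Rinv_le_contravar; lra).
  assert (ij : i - j <= i * i).
  { replace (i - j) with (i * j) by (unfold i, j; field; lra). nra. }
  unfold gauss_incr'; rewrite (S_INR (S n)); fold j.
  rewrite Cmod_mult, Cmod_Cexp.
  replace (exp r * (1 + r) / INR (S n) ^ 2) with (exp r * ((1 + r) * (i * i)))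
    by (unfold i; field; lra).
  apply Rmult_le_compat; [apply Rlt_le, exp_pos | apply Cmod_ge_0 | |].
  - assert (Re (s * log_ratio n)%C <= r).
    { replace (Re (s * log_ratio n)%C) with (Re s * log_ratio n) by (unfold Re; simpl; ring).
      eapply Rle_trans; [apply Rle_abs|]; rewrite Rabs_mult.
      assert (Rabs (log_ratio n) <= 1) by (apply Rabs_le; lra).
      generalize (re_le_Cmod s) (Rabs_pos (Re s)) (Rabs_pos (log_ratio n)); nra. }
    destruct H as [H|H]; [apply Rlt_le, exp_increasing, H | rewrite H; lra].
  - eapply Rle_trans; [apply Cmod_triangle|].
    rewrite Cmod_mult, !Cmod_R, Rabs_mult, (Rabs_pos_eq j) by lra.
    assert (Rabs (j + log_ratio n) <= i * i) by (apply Rabs_le; lra).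
    assert (Rabs (log_ratio n) <= i) by (apply Rabs_le; lra).
    assert (Rabs (log_ratio n) * j <= i * i).
    { apply Rmult_le_compat; try lra; apply Rabs_pos. }
    assert (0 <= Rabs (log_ratio n) * j) by (apply Rmult_le_pos; [apply Rabs_pos | lra]).
    generalize (Cmod_ge_0 s); nra.
Qed.

Lemma is_Cderive_gauss_incr (n : nat) (p q : C) (t : R) :
  is_Cderive (fun t : R => gauss_incr n (p + t * q))%C t (q * gauss_incr' n (p + t * q))%C.
Proof.
  unfold gauss_incr, gauss_incr'.
  set (j := / INR (S (S n))); set (L := log_ratio n).
  apply (is_Cderive_ext
    (fun t : R => ((1 + p * j) + t * (q * j)) * Cexp (p * L + t * (q * L)) + - (1))%C).
  { intros s; replace (p * L + s * (q * L))%C with ((p + s * q) * L)%C by ring; ring. }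
  replace (q * (Cexp ((p + t * q) * L) * ((j + L)%R + (p + t * q) * (L * j)%R)))%C with
    (((q * j) * Cexp (p * L + t * (q * L)) +
      ((1 + p * j) + t * (q * j)) * (q * L * Cexp (p * L + t * (q * L)))) + 0)%C.
  2:{ replace (p * L + t * (q * L))%C with ((p + t * q) * L)%C by ring.
      rewrite RtoC_plus, RtoC_mult; ring. }
  apply is_Cderive_plus; [|apply is_Cderive_const].
  apply (is_Cderive_mult (fun t : R => (1 + p * j) + t * (q * j))%C
          (fun t : R => Cexp (p * L + t * (q * L)))).
  - apply is_Cderive_affine.
  - apply is_Cderive_Cexp.
Qed.

(** [gauss_incr n] vanishes at 0, so along the segment from 0 to [s] it is
    controlled by its derivative. *)
Lemma Cmod_gauss_incr_le (n : nat) (s : C) (r : R) :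
  Cmod s <= r -> Cmod (gauss_incr n s) <= 2 * r * (exp r * (1 + r)) / INR (S n) ^ 2.
Proof.
  intros Hs.
  assert (r0 : 0 <= r) by (generalize (Cmod_ge_0 s); lra).
  replace (gauss_incr n s) with (gauss_incr n (0 + 1%R * s) - gauss_incr n (0 + 0%R * s))%C.
  2:{ replace (0 + 1%R * s)%C with s by ring. replace (0 + 0%R * s)%C with (RtoC 0) by ring.
      replace (gauss_incr n 0%C) with (RtoC 0); [ring|].
      unfold gauss_incr. replace (0 * log_ratio n)%C with (RtoC 0) by ring; rewrite Cexp_0; ring. }
  replace (2 * r * (exp r * (1 + r)) / INR (S n) ^ 2) with
    (2 * (r * (exp r * (1 + r) / INR (S n) ^ 2))) by (unfold Rdiv; ring).
  apply (Cmod_increment_le (fun t : R => gauss_incr n (0 + t * s))%C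
    (fun t : R => s * gauss_incr' n (0 + t * s))%C).
  intros t Ht; split; [apply is_Cderive_gauss_incr|].
  rewrite Cmod_mult; apply Rmult_le_compat; try apply Cmod_ge_0; auto.
  apply Cmod_gauss_incr'_le.
  replace (0 + t * s)%C with (t * s)%C by ring.
  rewrite Cmod_mult, Cmod_R, Rabs_pos_eq by lra.
  generalize (Cmod_ge_0 s); nra.
Qed.

Lemma is_Cderive_gauss_prod (n : nat) (b : C) (t : R) :
  is_Cderive (fun t : R => gauss_prod n (b + t))%C t (gauss_prod' n (b + t)%C).
Proof.
  assert (A : forall p : C, is_Cderive (fun t : R => p + t)%C t (RtoC 1)).
  { intros p; apply (is_Cderive_ext (fun t : R => p + t * 1)%C).
    - intros s; simpl; ring.
    - apply is_Cderive_affine. }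
  induction n as [|n IH]; simpl.
  - replace (2 * (b + t) + 1)%C with (1 * (b + t + 1) + (b + t) * (1 + 0))%C by ring.
    apply (is_Cderive_mult (fun t : R => b + t)%C (fun t : R => b + t + 1)%C); [apply A|].
    apply is_Cderive_plus; [apply A | apply is_Cderive_const].
  - apply (is_Cderive_mult (fun t : R => gauss_prod n (b + t))%C
            (fun t : R => 1 + gauss_incr n (b + t))%C); [exact IH|].
    replace (gauss_incr' n (b + t)%C) with (0 + 1 * gauss_incr' n (b + t * 1))%C.
    2:{ replace (b + t * 1)%C with (b + t)%C by ring; ring. }
    apply is_Cderive_plus; [apply is_Cderive_const|].
    apply (is_Cderive_ext (fun t : R => gauss_incr n (b + t * 1))%C).
    + intros s; f_equal; ring.
    + apply is_Cderive_gauss_incr.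
Qed.

Lemma Ccontinuous_gauss_incr (n : nat) (b : C) (t : R) :
  Ccontinuous (fun t : R => gauss_incr n (b + t))%C t.
Proof.
  apply (Ccontinuous_ext (fun t : R => gauss_incr n (b + t * 1))%C).
  - intros s; f_equal; ring.
  - eapply is_Cderive_continuous, is_Cderive_gauss_incr.
Qed.

Lemma Ccontinuous_gauss_incr' (n : nat) (b : C) (t : R) :
  Ccontinuous (fun t : R => gauss_incr' n (b + t))%C t.
Proof.
  unfold gauss_incr'; set (j := / INR (S (S n))); set (L := log_ratio n).
  apply Ccontinuous_mult.
  - apply (Ccontinuous_ext (fun t : R => Cexp (b * L + t * L))%C).
    + intros s; f_equal; ring.
    + eapply is_Cderive_continuous, is_Cderive_Cexp.
  - apply (Ccontinuous_ext (fun t : R => ((j + L)%R + b * (L * j)%R) + t * (L * j)%R)%C).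
    + intros s; ring.
    + apply Ccontinuous_affine.
Qed.

Lemma Ccontinuous_gauss_prod' (n : nat) (b : C) (t : R) :
  Ccontinuous (fun t : R => gauss_prod' n (b + t))%C t.
Proof.
  induction n as [|n IH]; simpl.
  - apply (Ccontinuous_ext (fun t : R => (2 * b + 1) + t * 2)%C); [intros s; ring|].
    apply Ccontinuous_affine.
  - apply Ccontinuous_plus; apply Ccontinuous_mult.
    + exact IH.
    + apply Ccontinuous_plus; [apply Ccontinuous_const | apply Ccontinuous_gauss_incr].
    + eapply is_Cderive_continuous, is_Cderive_gauss_prod.
    + apply Ccontinuous_gauss_incr'.
Qed.

(** The first factor bounds the initial values of [gauss_prod] and [gauss_prod'], the
    second one their growth. *)
Definition prod_bound (r : R) : R :=
  (r * (r + 1) + (2 * r + 1)) * exp (4 * incr_const r).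

Lemma incr_const_ge_0 (r : R) : 0 <= r -> 0 <= incr_const r.
Proof.
  intros H; unfold incr_const; generalize (exp_pos r); intros E.
  repeat apply Rmult_le_pos; lra.
Qed.

(** Since the factors are [1 + O(1/n^2)], the partial products and their
    derivatives stay bounded: the sum of both grows at each step by a factor at
    most [exp (2 c / n^2)], and the exponents telescope. *)
Lemma gauss_prod_bounded (n : nat) (s : C) (r : R) :
  Cmod s <= r -> Cmod (gauss_prod n s) + Cmod (gauss_prod' n s) <= prod_bound r.
Proof.
  intros Hs.
  assert (r0 : 0 <= r) by (generalize (Cmod_ge_0 s); lra).
  assert (c0 := incr_const_ge_0 r r0).
  set (a := r * (r + 1) + (2 * r + 1)).
  assert (a0 : 0 <= a) by (unfold a; nra).
  assert (B : Cmod (gauss_prod n s) + Cmod (gauss_prod' n s)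
              <= a * exp (4 * incr_const r * (1 - / INR (S n)))).
  { induction n as [|n IH].
    - replace (4 * incr_const r * (1 - / INR 1)) with 0 by (simpl; field).
      rewrite exp_0, Rmult_1_r; simpl; rewrite Cmod_mult; unfold a.
      assert (T1 := Cmod_triangle s 1%C); rewrite Cmod_1 in T1.
      assert (T2 := Cmod_triangle (2 * s)%C 1%C); rewrite Cmod_1, Cmod_mult, Cmod_R in T2.
      rewrite (Rabs_pos_eq 2) in T2 by lra.
      generalize (Cmod_ge_0 s) (Cmod_ge_0 (s + 1)%C); nra.
    - assert (P : 1 <= INR (S n)) by (apply (le_INR 1); lia).
      set (c := incr_const r / INR (S n) ^ 2).
      assert (i0 : 0 < / INR (S n) ^ 2) by (apply Rinv_0_lt_compat, pow_lt; lra).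
      assert (Hu : Cmod (gauss_incr n s) <= c).
      { eapply Rle_trans; [apply (Cmod_gauss_incr_le n s r Hs)|].
        unfold c, incr_const, Rdiv; apply Rmult_le_compat_r; [lra|].
        apply Rmult_le_compat_r; [|lra].
        generalize (exp_pos r); intros; apply Rmult_le_pos; lra. }
      assert (Hu' : Cmod (gauss_incr' n s) <= c).
      { eapply Rle_trans; [apply (Cmod_gauss_incr'_le n s r Hs)|].
        unfold c, incr_const, Rdiv; apply Rmult_le_compat_r; [lra|].
        rewrite <- (Rmult_1_l (exp r * (1 + r))) at 1.
        apply Rmult_le_compat_r; [|lra].
        generalize (exp_pos r); intros; apply Rmult_le_pos; lra. }
      assert (H1 : Cmod (1 + gauss_incr n s)%C <= 1 + c).
      { eapply Rle_trans; [apply Cmod_triangle|]; rewrite Cmod_1; lra. }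
      assert (cc : 2 * c <= 4 * incr_const r * (/ INR (S n) - / INR (S (S n)))).
      { rewrite (S_INR (S n)); unfold c.
        replace (/ INR (S n) - / (INR (S n) + 1)) with (/ (INR (S n) * (INR (S n) + 1))) by (field; lra).
        assert (/ (2 * INR (S n) ^ 2) <= / (INR (S n) * (INR (S n) + 1))).
        { apply Rinv_le_contravar; nra. }
        rewrite Rinv_mult in H. unfold Rdiv. nra. }
      replace (4 * incr_const r * (1 - / INR (S (S n)))) with
        (4 * incr_const r * (1 - / INR (S n)) +
         4 * incr_const r * (/ INR (S n) - / INR (S (S n)))) by ring.
      rewrite exp_plus.
      assert (E : 1 + 2 * c <= exp (4 * incr_const r * (/ INR (S n) - / INR (S (S n))))).
      { eapply Rle_trans; [|apply exp_ineq1_le]; lra. }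
      change (gauss_prod (S n) s) with (gauss_prod n s * (1 + gauss_incr n s))%C.
      change (gauss_prod' (S n) s) with
        (gauss_prod' n s * (1 + gauss_incr n s) + gauss_prod n s * gauss_incr' n s)%C.
      assert (T := Cmod_triangle (gauss_prod' n s * (1 + gauss_incr n s))%C
                     (gauss_prod n s * gauss_incr' n s)%C).
      rewrite !Cmod_mult in *.
      generalize (Cmod_ge_0 (gauss_prod n s)) (Cmod_ge_0 (gauss_prod' n s))
        (Cmod_ge_0 (gauss_incr' n s)) (Cmod_ge_0 (1 + gauss_incr n s)%C); intros.
      apply Rle_trans with ((Cmod (gauss_prod n s) + Cmod (gauss_prod' n s)) * (1 + 2 * c)).
      + nra.
      + rewrite <- Rmult_assoc; apply Rmult_le_compat; try lra. }
  eapply Rle_trans; [exact B|]; unfold prod_bound; fold a.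
  apply Rmult_le_compat_l; [exact a0|].
  assert (P : 0 < / INR (S n)) by (apply Rinv_0_lt_compat, lt_0_INR; lia).
  assert (X : 4 * incr_const r * (1 - / INR (S n)) <= 4 * incr_const r) by nra.
  destruct X as [X|X]; [apply Rlt_le, exp_increasing, X | rewrite X; lra].
Qed.

(** The partial products written as a series, for termwise differentiation. *)
Definition gauss_term (n : nat) (s : C) : C :=
  match n with
  | O => gauss_prod 0 s
  | S m => gauss_prod m s * gauss_incr m s
  end%C.

Definition gauss_term' (n : nat) (s : C) : C :=
  match n with
  | O => gauss_prod' 0 s
  | S m => gauss_prod' m s * gauss_incr m s + gauss_prod m s * gauss_incr' m s
  end%C.

Definition gauss_majorant (r : R) (n : nat) : R :=
  match n with
  | O => prod_bound r
  | S m => prod_bound r * incr_const r * / INR (S m) ^ 2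
  end.

Lemma sum_gauss_term (n : nat) (s : C) :
  sum_n (G := C_R_NormedModule) (fun k => gauss_term k s) n = gauss_prod n s.
Proof.
  induction n as [|n IH]; [now rewrite sum_O|].
  rewrite sum_Sn, IH; simpl.
  change (gauss_prod n s + gauss_prod n s * gauss_incr n s = gauss_prod n s * (1 + gauss_incr n s))%C.
  ring.
Qed.

Lemma gauss_term_le (n : nat) (s : C) (r : R) :
  Cmod s <= r ->
  Cmod (gauss_term n s) <= gauss_majorant r n /\ Cmod (gauss_term' n s) <= gauss_majorant r n.
Proof.
  intros Hs; destruct n as [|n].
  - assert (H := gauss_prod_bounded 0 s r Hs).
    generalize (Cmod_ge_0 (gauss_prod 0 s)) (Cmod_ge_0 (gauss_prod' 0 s)).
    simpl gauss_term; simpl gauss_term'; simpl in H |- *; lra.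
  - change (gauss_majorant r (S n)) with (prod_bound r * incr_const r * / INR (S n) ^ 2).
    assert (H := gauss_prod_bounded n s r Hs).
    assert (r0 : 0 <= r) by (generalize (Cmod_ge_0 s); lra).
    assert (Hu := Cmod_gauss_incr_le n s r Hs).
    assert (Hu' := Cmod_gauss_incr'_le n s r Hs).
    assert (P : 0 < / INR (S n) ^ 2) by (apply Rinv_0_lt_compat, pow_lt, lt_0_INR; lia).
    change (gauss_term (S n) s) with (gauss_prod n s * gauss_incr n s)%C.
    change (gauss_term' (S n) s) with
      (gauss_prod' n s * gauss_incr n s + gauss_prod n s * gauss_incr' n s)%C.
    assert (T := Cmod_triangle (gauss_prod' n s * gauss_incr n s)%C
                   (gauss_prod n s * gauss_incr' n s)%C).
    rewrite !Cmod_mult in *.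
    set (e := exp r * (1 + r)) in *.
    assert (e0 : 0 <= e) by (unfold e; generalize (exp_pos r); intros; apply Rmult_le_pos; lra).
    unfold Rdiv in *.
    set (i := / INR (S n) ^ 2) in *.
    assert (Cmod (gauss_incr n s) <= incr_const r * i).
    { eapply Rle_trans; [exact Hu|]; apply Rmult_le_compat_r; [lra|]; unfold incr_const; fold e; nra. }
    assert (Cmod (gauss_incr' n s) <= incr_const r * i).
    { eapply Rle_trans; [exact Hu'|]; apply Rmult_le_compat_r; [lra|]; unfold incr_const; fold e; nra. }
    generalize (Cmod_ge_0 (gauss_prod n s)) (Cmod_ge_0 (gauss_prod' n s))
        (Cmod_ge_0 (gauss_incr' n s)) (Cmod_ge_0 (gauss_incr n s)); intros.
    rewrite Rmult_assoc; set (c := incr_const r * i) in *.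
    split.
    + apply Rmult_le_compat; auto using Cmod_ge_0; lra.
    + eapply Rle_trans; [exact T|].
      apply Rle_trans with ((Cmod (gauss_prod n s) + Cmod (gauss_prod' n s)) * c); nra.
Qed.

Lemma ex_series_gauss_majorant (r : R) : ex_series (gauss_majorant r).
Proof.
  apply ex_series_incr_1; simpl.
  apply (ex_series_scal_l (K := R_AbsRing) (V := R_NormedModule)), ex_series_inv_sqr.
Qed.

Lemma gauss_limit (s : C) :
  filterlim (gauss s) eventually (Clocally (CSeries (fun n => gauss_term n s))).
Proof.
  assert (H : is_Cseries (fun n => gauss_term n s) (CSeries (fun n => gauss_term n s))).
  { apply (CSeries_correct _ (gauss_majorant (Cmod s))); [|apply ex_series_gauss_majorant].
    intros n; apply gauss_term_le, Rle_refl. }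
  intros P HP; destruct (H P HP) as [N HN].
  exists (S N); intros [|n] Hn; [lia|].
  rewrite gauss_eq_prod, <- sum_gauss_term; apply HN; lia.
Qed.

Lemma recip_Gamma_eq (s : C) : recip_Gamma s = CSeries (fun n => gauss_term n s).
Proof.
  apply (iota_filterlim_locally (V := C_R_CompleteNormedModule) (F := eventually)).
  exact (gauss_limit s).
Qed.

Lemma recip_Gamma_limit (s : C) : filterlim (gauss s) eventually (Clocally (recip_Gamma s)).
Proof. rewrite recip_Gamma_eq; apply gauss_limit. Qed.

Definition recip_Gamma' (s : C) : C := CSeries (fun n => gauss_term' n s).

Lemma recip_Gamma_C1 (b : C) (t : R) :
  is_Cderive (fun t : R => recip_Gamma (b + t)%C) t (recip_Gamma' (b + t)%C) /\
  Ccontinuous (fun t : R => recip_Gamma' (b + t)%C) t.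
Proof.
  assert (K : forall y, Boule t (mkposreal 1 Rlt_0_1) y -> Cmod (b + y)%C <= Cmod b + (Rabs t + 1)).
  { unfold Boule; simpl; intros y Hy; eapply Rle_trans; [apply Cmod_triangle|].
    rewrite Cmod_R; generalize (Rabs_triang_inv y t); lra. }
  destruct (CSeries_derive (fun n y => gauss_term n (b + y)%C) (fun n y => gauss_term' n (b + y)%C)
    (gauss_majorant (Cmod b + (Rabs t + 1))) t (mkposreal 1 Rlt_0_1)) with t as [D Cn].
  - intros [|n] y _; [apply (is_Cderive_gauss_prod 0)|].
    apply (is_Cderive_mult (fun t : R => gauss_prod n (b + t))%C
            (fun t : R => gauss_incr n (b + t))%C); [apply is_Cderive_gauss_prod|].
    apply (is_Cderive_ext (fun t : R => gauss_incr n (b + t * 1))%C).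
    + intros s; f_equal; ring.
    + replace (gauss_incr' n (b + y)%C) with (1 * gauss_incr' n (b + y * 1))%C.
      * apply is_Cderive_gauss_incr.
      * replace (b + y * 1)%C with (b + y)%C by ring; ring.
  - intros [|n] y _; [apply (Ccontinuous_gauss_prod' 0)|]; simpl.
    apply Ccontinuous_plus; apply Ccontinuous_mult.
    + apply Ccontinuous_gauss_prod'.
    + apply Ccontinuous_gauss_incr.
    + eapply is_Cderive_continuous, is_Cderive_gauss_prod.
    + apply Ccontinuous_gauss_incr'.
  - intros n y Hy; apply gauss_term_le, K, Hy.
  - intros n y Hy; apply gauss_term_le, K, Hy.
  - apply ex_series_gauss_majorant.
  - unfold Boule; simpl; rewrite Rminus_diag, Rabs_R0; lra.
  - split; [|exact Cn].
    apply (is_Cderive_ext (fun t : R => CSeries (fun n => gauss_term n (b + t)%C))).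
    + intros s; symmetry; apply recip_Gamma_eq.
    + exact D.
Qed.

(** * The functional equation and the decay it forces *)

Lemma rising_succ_l (s : C) (n : nat) : rising s (S n) = (s * rising (s + 1) n)%C.
Proof.
  induction n as [|n IH]; [simpl; ring|].
  change (rising s (S (S n))) with (rising s (S n) * (s + INR (S n)))%C.
  rewrite IH, S_INR, RtoC_plus; simpl rising; ring.
Qed.

Lemma gauss_succ_arg (s : C) (n : nat) : (0 < n)%nat ->
  (s * gauss (s + 1) n)%C = (gauss s n * (1 + (s + 1) * (/ INR n)%R))%C.
Proof.
  intros Hn.
  assert (P : 0 < INR n) by (apply lt_0_INR, Hn).
  unfold gauss.
  replace ((s + 1) * ln (INR n))%C with (s * ln (INR n) + ln (INR n))%C by ring.
  rewrite Cexp_plus, (Cexp_ln _ P).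
  assert (E : rising (s + 1)%C (S n) = (rising (s + 1)%C n * (s + 1 + INR n))%C) by reflexivity.
  rewrite E, (rising_succ_l s n), RtoC_inv by lra.
  field; repeat split; try apply Cexp_neq_0; apply RtoC_neq_0.
  - lra.
  - apply not_0_INR, fact_neq_0.
Qed.

(** The functional equation [Gamma (s + 1) = s Gamma s]. *)
Lemma recip_Gamma_succ (s : C) : recip_Gamma s = (s * recip_Gamma (s + 1))%C.
Proof.
  apply (Cseq_unique (fun n => s * gauss (s + 1) n)%C).
  - replace (recip_Gamma s) with (recip_Gamma s * (1 + (s + 1) * 0))%C by ring.
    apply (filterlim_ext_loc (fun n => gauss s n * (1 + (s + 1) * (/ INR n)%R))%C).
    { exists 1%nat; intros n Hn; symmetry; apply gauss_succ_arg; lia. }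
    apply filterlim_Cmult; [apply eventually_filter | apply recip_Gamma_limit |].
    apply filterlim_Cplus; [apply eventually_filter | apply filterlim_const |].
    apply filterlim_Cmult; [apply eventually_filter | apply filterlim_const |].
    apply filterlim_C_pair;
      [apply eventually_filter | | exact (filterlim_const (U := R_UniformSpace) 0)].
    change (is_lim_seq (fun n => / INR n) (Rbar_inv p_infty)).
    apply is_lim_seq_inv; [apply is_lim_seq_INR | discriminate].
  - apply filterlim_Cmult; [apply eventually_filter | apply filterlim_const |].
    apply recip_Gamma_limit.
Qed.

(** [z^t / Gamma (b + t)]: its values at the multiples of [a] are the terms of
    [E_{a,b}(z^a)]. *)
Definition ml_term (b logz : C) (t : R) : C := (recip_Gamma (b + t) * Cexp (t * logz))%C.

Definition ml_term' (b logz : C) (t : R) : C :=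
  (recip_Gamma' (b + t) * Cexp (t * logz) + recip_Gamma (b + t) * (logz * Cexp (t * logz)))%C.

Lemma ml_term_derive (b logz : C) (t : R) :
  is_Cderive (ml_term b logz) t (ml_term' b logz t).
Proof.
  apply (is_Cderive_mult (fun t : R => recip_Gamma (b + t)%C) (fun t : R => Cexp (t * logz))%C).
  - apply recip_Gamma_C1.
  - apply is_Cderive_Cexp_linear.
Qed.

Lemma Ccontinuous_ml_term' (b logz : C) (t : R) : Ccontinuous (ml_term' b logz) t.
Proof.
  assert (Hexp : Ccontinuous (fun s : R => Cexp (s * logz)) t).
  { eapply is_Cderive_continuous, is_Cderive_Cexp_linear. }
  apply Ccontinuous_plus; apply Ccontinuous_mult.
  - apply recip_Gamma_C1.
  - exact Hexp.
  - eapply is_Cderive_continuous, recip_Gamma_C1.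
  - apply Ccontinuous_mult; [apply Ccontinuous_const | exact Hexp].
Qed.

Lemma ml_term_succ (b logz : C) (t : R) :
  (Cexp logz * ml_term b logz t)%C = ((b + t) * ml_term b logz (t + 1))%C.
Proof.
  unfold ml_term; rewrite recip_Gamma_succ.
  rewrite RtoC_plus.
  replace ((t + 1) * logz)%C with (t * logz + logz)%C by ring.
  rewrite Cexp_plus; replace (b + (t + 1))%C with (b + t + 1)%C by ring; ring.
Qed.

(** The derivative of [ml_term_succ], by uniqueness of derivatives. *)
Lemma ml_term'_succ (b logz : C) (t : R) :
  (Cexp logz * ml_term' b logz t)%C =
  (ml_term b logz (t + 1) + (b + t) * ml_term' b logz (t + 1))%C.
Proof.
  apply (is_Cderive_unique (fun s => Cexp logz * ml_term b logz s)%C t).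
  - replace (Cexp logz * ml_term' b logz t)%C with
      (0 * ml_term b logz t + Cexp logz * ml_term' b logz t)%C by ring.
    apply (is_Cderive_mult (fun _ => Cexp logz)); [apply is_Cderive_const | apply ml_term_derive].
  - apply (is_Cderive_ext (fun s : R => (b + s * 1) * ml_term b logz (s + 1))%C).
    { intros s; rewrite ml_term_succ; ring. }
    replace (ml_term b logz (t + 1) + (b + t) * ml_term' b logz (t + 1))%C with
      (1 * ml_term b logz (t + 1) + (b + t * 1) * (ml_term' b logz (t + 1)))%C by ring.
    apply (is_Cderive_mult (fun s : R => b + s * 1)%C (fun s => ml_term b logz (s + 1))).
    + apply is_Cderive_affine.
    + replace (ml_term' b logz (t + 1)) with (scal (V := C_R_NormedModule) 1 (ml_term' b logz (t + 1))).
      2: apply (scal_one (V := C_R_NormedModule)).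
      apply (is_derive_comp (V := C_R_NormedModule) (ml_term b logz) (fun s => s + 1)).
      * apply ml_term_derive.
      * auto_derive; auto; ring.
Qed.

(** From [t - 1] to [t >= 2] the fourth power grows by a factor at most 16, which the
    decrease of [f] absorbs; so the maximum of [f t * t^4] over a compact initial
    interval is a bound everywhere. *)
Lemma quartic_decay (f : R -> R) (T : R) :
  1 <= T -> (forall t, 0 <= f t) -> (forall t, continuous f t) ->
  (forall t, T <= t -> 16 * f (t + 1) <= f t) ->
  exists K, forall t, 0 <= t -> f t * t ^ 4 <= K.
Proof.
  intros HT Hpos Hc Hdec.
  destruct (continuity_ab_maj (fun t => f t * t ^ 4) 0 (T + 1)) as [M [HM _]]; [lra| |].
  { intros t _; apply continuity_pt_filterlim.
    apply (continuous_mult (K := R_AbsRing) f (fun t => t ^ 4)); [apply Hc|].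
    apply (ex_derive_continuous (V := R_NormedModule)); auto_derive; auto. }
  exists (f M * M ^ 4).
  assert (I : forall n t, 0 <= t <= T + 1 + INR n -> f t * t ^ 4 <= f M * M ^ 4).
  { induction n as [|n IH]; intros t Ht.
    - apply HM; simpl in Ht; lra.
    - rewrite S_INR in Ht.
      destruct (Rle_dec t (T + 1)) as [L|L]; [apply HM; lra|].
      apply Rnot_le_lt in L.
      eapply Rle_trans; [|apply (IH (t - 1)); lra].
      assert (D := Hdec (t - 1) ltac:(lra)); replace (t - 1 + 1) with t in D by ring.
      assert (P : t ^ 4 <= 16 * (t - 1) ^ 4).
      { replace (16 * (t - 1) ^ 4) with ((2 * (t - 1)) ^ 4) by ring.
        apply pow_incr; lra. }
      assert (Q : 0 <= (t - 1) ^ 4) by (apply pow_le; lra).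
      generalize (Hpos t); nra. }
  intros t Ht.
  destruct (nfloor_ex t Ht) as [n Hn].
  apply (I (S n)); rewrite S_INR; lra.
Qed.

(** Once [|b + t|] is large, one step of the functional equation divides the
    size of [ml_term] and of its derivative by any prescribed constant, so both
    decay faster than any power; the fourth power is all that is used below. *)
Lemma ml_term_decay (b logz : C) :
  exists K, forall t, 0 <= t ->
    Cmod (ml_term b logz t) * t ^ 4 <= K /\ Cmod (ml_term' b logz t) * t ^ 4 <= K.
Proof.
  set (z := Cmod (Cexp logz)).
  assert (z0 : 0 < z) by (unfold z; rewrite Cmod_Cexp; apply exp_pos).
  destruct (quartic_decay (fun t => Cmod (ml_term b logz t) + Cmod (ml_term' b logz t))
    (Cmod b + (1 + 32 * z))) as [K HK].
  - generalize (Cmod_ge_0 b); lra.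
  - intros t; generalize (Cmod_ge_0 (ml_term b logz t)) (Cmod_ge_0 (ml_term' b logz t)); lra.
  - intros t; apply (continuous_plus (V := R_NormedModule)); apply continuous_Cmod.
    + eapply is_Cderive_continuous, ml_term_derive.
    + apply Ccontinuous_ml_term'.
  - intros t Ht.
    assert (E := f_equal Cmod (ml_term_succ b logz t)).
    assert (E' : Cmod ((b + t) * ml_term' b logz (t + 1))%C <=
                 Cmod (Cexp logz * ml_term' b logz t)%C + Cmod (ml_term b logz (t + 1))).
    { replace ((b + t) * ml_term' b logz (t + 1))%C with
        (Cexp logz * ml_term' b logz t - ml_term b logz (t + 1))%C.
      - apply Cmod_triangle_minus.
      - rewrite ml_term'_succ; ring. }
    rewrite !Cmod_mult in *; fold z in E, E'.
    assert (Hq : 1 + 32 * z <= Cmod (b + t)%C).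
    { assert (T := Cmod_triangle_minus (b + t)%C b).
      replace (b + t - b)%C with (RtoC t) in T by ring.
      rewrite Cmod_R, Rabs_pos_eq in T; generalize (Cmod_ge_0 b); lra. }
    set (q := Cmod (b + t)%C) in *.
    generalize (Cmod_ge_0 (ml_term b logz t)) (Cmod_ge_0 (ml_term' b logz t))
      (Cmod_ge_0 (ml_term b logz (t + 1))) (Cmod_ge_0 (ml_term' b logz (t + 1))).
    set (X := Cmod (ml_term b logz t)) in *; set (X' := Cmod (ml_term' b logz t)) in *.
    set (Y := Cmod (ml_term b logz (t + 1))) in *; set (Y' := Cmod (ml_term' b logz (t + 1))) in *.
    intros X0 X0' Y0 Y0'.
    assert (Y1 : Y <= z * X) by nra.
    assert (q * (Y + Y') <= 2 * z * (X + X')) by nra.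
    assert (32 * z * (Y + Y') <= 2 * z * (X + X')) by nra.
    apply (Rmult_le_reg_l (2 * z)); lra.
  - exists K; intros t Ht; specialize (HK t Ht).
    generalize (Cmod_ge_0 (ml_term b logz t)) (Cmod_ge_0 (ml_term' b logz t)); intros.
    assert (0 <= t ^ 4) by (apply pow_le, Ht).
    split; nra.
Qed.

(** * The Mittag-Leffler function along [z^a] *)

Definition ml_sum (b logz : C) (a : R) : C :=
  CSeries (fun k => ml_term b logz (a * INR k)).

Definition ml_sum' (b logz : C) (a : R) : C :=
  CSeries (fun k => INR k * ml_term' b logz (a * INR k))%C.

(** The factor [k + 1] on the left is the one that differentiating
    [ml_term (a (k + 1))] in [a] brings out; the decay pays for it. *)
Lemma decay_bound (w : C) (K a : R) (k : nat) :
  0 < a -> Cmod w * (a * INR (S k)) ^ 4 <= K ->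
  INR (S k) * Cmod w <= K * / a ^ 4 * / INR (S k) ^ 2.
Proof.
  intros Ha H.
  assert (P : 1 <= INR (S k)) by (apply (le_INR 1); lia).
  assert (A : 0 < a ^ 4) by (apply pow_lt, Ha).
  assert (N : 0 < INR (S k) ^ 2) by (apply pow_lt; lra).
  apply (Rmult_le_reg_r (a ^ 4 * INR (S k) ^ 2)); [apply Rmult_lt_0_compat; assumption|].
  replace (K * / a ^ 4 * / INR (S k) ^ 2 * (a ^ 4 * INR (S k) ^ 2)) with K
    by (field; split; lra).
  eapply Rle_trans; [|exact H].
  rewrite Rpow_mult_distr.
  replace (INR (S k) * Cmod w * (a ^ 4 * INR (S k) ^ 2)) with
    (Cmod w * a ^ 4 * INR (S k) ^ 3) by ring.
  replace (Cmod w * (a ^ 4 * INR (S k) ^ 4)) with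
    (Cmod w * a ^ 4 * INR (S k) ^ 4) by ring.
  apply Rmult_le_compat_l.
  - apply Rmult_le_pos; [apply Cmod_ge_0 | lra].
  - apply Rle_pow; [exact P | lia].
Qed.

Definition ml_majorant (K0 K1 : R) (k : nat) : R :=
  match k with O => K0 | S _ => K1 * / INR k ^ 2 end.

Lemma ex_series_ml_majorant (K0 K1 : R) : ex_series (ml_majorant K0 K1).
Proof.
  apply ex_series_incr_1.
  apply (ex_series_scal_l (K := R_AbsRing) (V := R_NormedModule)), ex_series_inv_sqr.
Qed.

Lemma ml_term_majorant (b logz : C) (K a : R) (k : nat) :
  (forall t, 0 <= t ->
    Cmod (ml_term b logz t) * t ^ 4 <= K /\ Cmod (ml_term' b logz t) * t ^ 4 <= K) ->
  0 < a ->
  Cmod (ml_term b logz (a * INR k)) <=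
    ml_majorant (Cmod (ml_term b logz 0)) (K * / a ^ 4) k /\
  Cmod (INR k * ml_term' b logz (a * INR k))%C <=
    ml_majorant (Cmod (ml_term b logz 0)) (K * / a ^ 4) k.
Proof.
  intros HK Ha; destruct k as [|k]; unfold ml_majorant.
  - simpl INR; rewrite Rmult_0_r, Cmod_mult, Cmod_0, Rmult_0_l.
    split; [lra | apply Cmod_ge_0].
  - assert (P : 1 <= INR (S k)) by (apply (le_INR 1); lia).
    destruct (HK (a * INR (S k))) as [H1 H2]; [apply Rmult_le_pos; lra|].
    split.
    + eapply Rle_trans; [|exact (decay_bound _ _ _ _ Ha H1)].
      generalize (Cmod_ge_0 (ml_term b logz (a * INR (S k)))); nra.
    + rewrite Cmod_mult, Cmod_R, Rabs_pos_eq by lra.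
      apply decay_bound; assumption.
Qed.

Lemma ml_sum_series (b logz : C) (a : R) : 0 < a ->
  is_Cseries (fun k => ml_term b logz (a * INR k)) (ml_sum b logz a).
Proof.
  intros Ha; destruct (ml_term_decay b logz) as [K HK].
  apply (CSeries_correct _ (ml_majorant (Cmod (ml_term b logz 0)) (K * / a ^ 4))).
  - intros k; apply ml_term_majorant; assumption.
  - apply ex_series_ml_majorant.
Qed.

(** On the interval of radius [a / 2] about [a] the bounds of [ml_term_majorant] are
    uniform, being worst at the left end. *)
Lemma ml_sum_C1 (b logz : C) (a : R) : 0 < a ->
  is_Cderive (ml_sum b logz) a (ml_sum' b logz a) /\ Ccontinuous (ml_sum' b logz) a.
Proof.
  intros Ha; destruct (ml_term_decay b logz) as [K HK].
  assert (K0 : 0 <= K).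
  { destruct (HK 0 (Rle_refl 0)) as [H _]; rewrite pow_i, Rmult_0_r in H by lia; exact H. }
  assert (a2 : 0 < a / 2) by lra.
  assert (Hy : forall y, Boule a (mkposreal _ a2) y -> a / 2 <= y).
  { unfold Boule; simpl; intros y H; apply Rabs_def2 in H; lra. }
  assert (Hm : forall k y, a / 2 <= y ->
    ml_majorant (Cmod (ml_term b logz 0)) (K * / y ^ 4) k <=
    ml_majorant (Cmod (ml_term b logz 0)) (K * / (a / 2) ^ 4) k).
  { intros [|k] y H; unfold ml_majorant; [lra|].
    apply Rmult_le_compat_r.
    - apply Rlt_le, Rinv_0_lt_compat, pow_lt, lt_0_INR; lia.
    - apply Rmult_le_compat_l; [exact K0|].
      apply Rinv_le_contravar; [apply pow_lt, a2 | apply pow_incr; lra]. }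
  apply (CSeries_derive (fun k y => ml_term b logz (y * INR k))
    (fun k y => INR k * ml_term' b logz (y * INR k))%C
    (ml_majorant (Cmod (ml_term b logz 0)) (K * / (a / 2) ^ 4)) a (mkposreal _ a2)).
  - intros k y _.
    apply (is_Cderive_ext (fun s => ml_term b logz (INR k * s))).
    + intros s; f_equal; ring.
    + rewrite (Rmult_comm y); apply is_Cderive_rescale, ml_term_derive.
  - intros k y _; apply Ccontinuous_mult; [apply Ccontinuous_const|].
    apply (continuous_comp (U := R_UniformSpace) (V := R_UniformSpace) (W := C_R_NormedModule)
      (fun s => s * INR k) (ml_term' b logz)).
    + apply (ex_derive_continuous (V := R_NormedModule)); auto_derive; auto.
    + apply Ccontinuous_ml_term'.
  - intros k y H; eapply Rle_trans; [|apply (Hm k y), Hy, H].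
    apply ml_term_majorant; [exact HK | specialize (Hy y H); lra].
  - intros k y H; eapply Rle_trans; [|apply (Hm k y), Hy, H].
    apply ml_term_majorant; [exact HK | specialize (Hy y H); lra].
  - apply ex_series_ml_majorant.
  - unfold Boule; simpl; rewrite Rminus_diag, Rabs_R0; lra.
Qed.

Lemma mittag_leffler_eq (a b w l : C) :
  is_Cseries (fun k => w ^ k * recip_Gamma (b + a * INR k))%C l -> mittag_leffler a b w = l.
Proof.
  intros H.
  apply (iota_filterlim_locally (V := C_R_CompleteNormedModule) (F := eventually)), H.
Qed.

Lemma mittag_leffler_plus (b logz : C) (a : R) : 0 < a ->
  mittag_leffler a b (Cpower logz a) = ml_sum b logz a.
Proof.
  intros Ha; apply mittag_leffler_eq.
  apply (is_series_ext (V := C_R_NormedModule) (fun k => ml_term b logz (a * INR k))).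
  - intros k; unfold ml_term, Cpower.
    rewrite <- Cexp_pow, RtoC_mult.
    replace (a * INR k * logz)%C with (a * logz * INR k)%C by ring.
    apply Cmult_comm.
  - apply ml_sum_series, Ha.
Qed.

(** * Moebius inversion *)

(** [moebius] is defined from [primes] and [logn], while the sums below test
    divisibility with [Nat.modulo]; the two meet in [eqb_modulo_dvdn]. *)
Module MoebiusArithmetic.
Import ssreflect ssrbool ssrfun eqtype ssrnat seq div prime.
Local Open Scope nat_scope.

Lemma eqb_modulo_dvdn m d : Nat.eqb (Nat.modulo m d) 0 = (d %| m).
Proof.
apply/idP/dvdnP => [/PeanoNat.Nat.eqb_eq/PeanoNat.Nat.Div0.mod_divides[k ->]|[k ->]].
  by exists k; rewrite mulnC.
by apply/PeanoNat.Nat.eqb_eq/PeanoNat.Nat.Div0.mod_divides; exists k; rewrite mulnC.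
Qed.

Lemma moebius1 : moebius 1 = 1%Z.
Proof. by []. Qed.

Lemma moebius_prime_mul p k : prime p -> 0 < k ->
  moebius (p * k) = if p %| k then 0%Z else (- moebius k)%Z.
Proof.
move=> p_pr k_gt0; rewrite /moebius.
have p_gt0 := prime_gt0 p_pr.
have logE q : logn q (p * k) = (q == p) + logn q k.
  by rewrite lognM // logn_prime // eq_sym.
case: (boolP (p %| k)) => [p_dvd_k|pNk].
  case: ifP => // /allP/(_ p).
  rewrite mem_primes p_pr muln_gt0 p_gt0 k_gt0 dvdn_mulr //= logE eqxx => /(_ isT).
  have : 0 < logn p k by rewrite logn_gt0 mem_primes p_pr k_gt0.
  by case: (logn p k).
have perm : perm_eq (primes (p * k)) (p :: primes k).
  apply: uniq_perm; rewrite /= ?primes_uniq // ?mem_primes ?(negPf pNk) ?andbF //.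
  by move=> q; rewrite primesM // primes_prime // !inE.
rewrite (perm_all _ perm) (perm_size perm) /= logE eqxx.
have -> : logn p k = 0 by apply/eqP; rewrite -leqn0 leqNgt logn_gt0 mem_primes (negPf pNk) !andbF.
have -> : all (fun q => Nat.eqb (logn q (p * k)) 1) (primes k) =
          all (fun q => Nat.eqb (logn q k) 1) (primes k).
  apply: eq_in_all => q; rewrite mem_primes => /and3P[_ _ q_dvd_k].
  by rewrite logE; case: eqP q_dvd_k => // ->; rewrite (negPf pNk).
case: all => //=.
rewrite -[LHS]/(Z.pow (-1) (Z.of_nat (size (primes k)).+1)).
by rewrite Nat2Z.inj_succ Z.pow_succ_r; lia.
Qed.

Lemma moebius_bound n : Z.le (Z.abs (moebius n)) 1.
Proof.
rewrite /moebius; case: all => //.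
by elim: (size _) => // k IHk; rewrite Nat2Z.inj_succ Z.pow_succ_r; lia.
Qed.

Lemma exists_prime_factor m : 1 < m -> exists p, prime p /\ exists k, m = p * k.
Proof.
move=> m_gt1; exists (pdiv m); split; first exact: pdiv_prime.
by exists (m %/ pdiv m); rewrite mulnC divnK ?pdiv_dvd.
Qed.

Lemma dvdn_prime_mul p d m : prime p -> ~~ (p %| d) -> (d %| p * m) = (d %| m).
Proof. by move=> p_pr pNd; rewrite Gauss_dvdr // coprime_sym prime_coprime. Qed.

End MoebiusArithmetic.

(** [divides 0 m] holds for [m = 0] only. *)
Definition divides (d m : nat) : bool := Nat.eqb (Nat.modulo m d) 0.

Lemma divides_iff (d m : nat) : divides d m = true <-> exists k, m = (d * k)%nat.
Proof. unfold divides; rewrite Nat.eqb_eq; apply Nat.Div0.mod_divides. Qed.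

Lemma divides_le (d m : nat) : (0 < m)%nat -> divides d m = true -> (d <= m)%nat.
Proof. intros Hm H; apply divides_iff in H; destruct H as [k ->]; destruct k; lia. Qed.

Lemma moebius_prime_mul (p k : nat) : prime.prime p = true -> (0 < k)%nat ->
  moebius (p * k) = if divides p k then 0%Z else (- moebius k)%Z.
Proof.
  intros Hp Hk; unfold divides; rewrite MoebiusArithmetic.eqb_modulo_dvdn.
  apply MoebiusArithmetic.moebius_prime_mul; [exact Hp|].
  apply (ssrbool.introT ssrnat.ltP), Hk.
Qed.

Lemma divides_prime_mul (p d m : nat) : prime.prime p = true -> divides p d = false ->
  divides d (p * m) = divides d m.
Proof.
  unfold divides; rewrite !MoebiusArithmetic.eqb_modulo_dvdn; intros Hp Hd.
  apply MoebiusArithmetic.dvdn_prime_mul; [exact Hp|].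
  rewrite Hd; reflexivity.
Qed.

Lemma exists_prime_factor (m : nat) : (1 < m)%nat ->
  exists p k, prime.prime p = true /\ m = (p * k)%nat.
Proof.
  intros Hm.
  destruct (MoebiusArithmetic.exists_prime_factor m) as (p & Hp & k & Hk).
  - apply (ssrbool.introT ssrnat.ltP), Hm.
  - exists p, k; split; [exact Hp | exact Hk].
Qed.

Lemma sum_n_const_zero {G : AbelianMonoid} (N : nat) : sum_n (fun _ => zero : G) N = zero.
Proof. apply sum_n_m_const_zero. Qed.

Definition sieve {G : AbelianMonoid} (n : nat) (u : nat -> G) (m : nat) : G :=
  if divides n m then u m else zero.

(** The multiples of [n] up to [M] are the [k * n] with [k <= M / n]. *)
Lemma sum_sieve {G : AbelianMonoid} (n : nat) (u : nat -> G) (M : nat) : (0 < n)%nat ->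
  sum_n (sieve n u) M = sum_n (fun k => u (k * n)%nat) (M / n).
Proof.
  intros Hn; induction M as [|M IH].
  - rewrite Nat.Div0.div_0_l, !sum_O; unfold sieve, divides.
    rewrite Nat.Div0.mod_0_l; reflexivity.
  - rewrite sum_Sn, IH; unfold sieve, divides.
    assert (E := Nat.div_mod_eq (S M) n).
    assert (L := Nat.mod_upper_bound (S M) n ltac:(lia)).
    set (q := (S M / n)%nat) in *; set (r := (S M mod n)%nat) in *; clearbody q r.
    destruct (Nat.eqb_spec r 0) as [r0|r0].
    + assert (Q : q = S (M / n)).
      { destruct q as [|q]; [lia|]; f_equal.
        apply (Nat.div_unique M n q (n - 1)); lia. }
      rewrite Q, sum_Sn; f_equal; f_equal; rewrite <- Q; lia.
    + rewrite plus_zero_r; f_equal.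
      symmetry; apply (Nat.div_unique M n q (r - 1)); lia.
Qed.

Definition divisor_moebius (m d : nat) : R := if divides d m then IZR (moebius d) else 0.

Lemma sum_n_zero_tail {G : AbelianMonoid} (u : nat -> G) (M N : nat) : (M <= N)%nat ->
  (forall k, (M < k)%nat -> u k = zero) -> sum_n u N = sum_n u M.
Proof.
  intros HMN Hu; induction HMN as [|N HMN IH]; [reflexivity|].
  rewrite sum_Sn, IH, Hu by lia; apply plus_zero_r.
Qed.

(** For [m = p m'] with [p] prime, the divisors [d] of [m] that are prime to [p]
    cancel against the divisors [p d]; those divisible by [p^2] contribute 0. *)
Lemma sum_divisor_moebius (m N : nat) : (1 <= m <= N)%nat ->
  sum_n (divisor_moebius m) N = if Nat.eqb m 1 then 1 else 0.
Proof.
  intros [Hm HN]; destruct (Nat.eqb_spec m 1) as [->|Hm1].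
  - rewrite (sum_n_zero_tail _ 1 N HN), sum_Sn, sum_O.
    + unfold divisor_moebius; simpl; rewrite MoebiusArithmetic.moebius1; apply Rplus_0_l.
    + intros k Hk; unfold divisor_moebius, divides.
      rewrite Nat.mod_small by lia; reflexivity.
  - destruct (exists_prime_factor m) as (p & m' & Hp & E); [lia|].
    assert (p0 : (0 < p)%nat) by (destruct p; [discriminate Hp | lia]).
    assert (m0 : (0 < m')%nat) by nia.
    set (f := divisor_moebius m).
    set (g := fun d => if divides p d then 0 else f d).
    rewrite (sum_n_ext f (fun d => plus (g d) (sieve p f d))).
    2:{ intros d; unfold g, sieve; destruct (divides p d);
        [exact (eq_sym (Rplus_0_l _)) | exact (eq_sym (Rplus_0_r _))]. }
    rewrite sum_n_plus, sum_sieve by exact p0.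
    rewrite (sum_n_zero_tail g (N / p) N).
    + rewrite <- sum_n_plus.
      rewrite (sum_n_ext _ (fun _ => zero)); [exact (sum_n_const_zero (G := R_AbelianMonoid) _)|].
      intros k; unfold g, f, divisor_moebius.
      destruct k as [|k].
      { replace (divides p 0) with true by (symmetry; apply divides_iff; exists 0%nat; lia).
        replace (divides (0 * p) m) with false; [apply Rplus_0_l|].
        symmetry; unfold divides; simpl; apply Nat.eqb_neq; lia. }
      rewrite (Nat.mul_comm (S k) p), moebius_prime_mul by (assumption || lia).
      assert (Hd : divides (p * S k) m = divides (S k) m').
      { apply Bool.eq_true_iff_eq; rewrite !divides_iff, E.
        split; intros [c Hc]; exists c; nia. }
      rewrite Hd; destruct (divides p (S k)) eqn:D.
      * destruct (divides (S k) m'); apply Rplus_0_l.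
      * rewrite E, divides_prime_mul by assumption.
        destruct (divides (S k) m'); [|apply Rplus_0_l].
        rewrite opp_IZR; apply Rplus_opp_r.
    + apply Nat.Div0.div_le_upper_bound; nia.
    + intros k Hk; unfold g, f, divisor_moebius.
      destruct (divides p k) eqn:D; [reflexivity|].
      rewrite E, divides_prime_mul by assumption.
      destruct (divides k m') eqn:D'; [|reflexivity].
      apply divides_le in D'; [|exact m0].
      assert (m' <= N / p)%nat by (apply Nat.div_le_lower_bound; lia).
      lia.
Qed.

Lemma divisor_moebius_bound (m d : nat) : Rabs (divisor_moebius m d) <= 1.
Proof.
  unfold divisor_moebius; destruct (divides d m).
  - rewrite <- abs_IZR; apply IZR_le, MoebiusArithmetic.moebius_bound.
  - rewrite Rabs_R0; lra.
Qed.

Lemma divisor_moebius_0 (m : nat) : (0 < m)%nat -> divisor_moebius m 0 = 0.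
Proof.
  intros Hm; unfold divisor_moebius, divides; simpl.
  destruct (Nat.eqb_spec m 0); [lia | reflexivity].
Qed.

Lemma sum_divisor_moebius_bound (m N : nat) : (0 < m)%nat ->
  Rabs (sum_n (divisor_moebius m) N) <= INR N.
Proof.
  intros Hm; induction N as [|N IH].
  - rewrite sum_O, divisor_moebius_0, Rabs_R0 by exact Hm; simpl; lra.
  - rewrite sum_Sn, S_INR; eapply Rle_trans; [apply Rabs_triang|].
    apply Rplus_le_compat; [exact IH | apply divisor_moebius_bound].
Qed.

Lemma is_Cseries_sieve (n : nat) (u : nat -> C) (l : C) : (0 < n)%nat ->
  is_Cseries (fun k => u (k * n)%nat) l -> is_Cseries (sieve (G := C_R_NormedModule) n u) l.
Proof.
  intros Hn H.
  apply (filterlim_ext (fun M => sum_n (G := C_R_NormedModule) (fun k => u (k * n)%nat) (M / n))).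
  { intros M; symmetry; apply (sum_sieve (G := C_R_NormedModule)), Hn. }
  apply (filterlim_comp _ _ _ (fun M => (M / n)%nat) _ eventually eventually); [|exact H].
  intros P [N HN]; exists (N * n)%nat; intros M HM; apply HN.
  apply Nat.div_le_lower_bound; lia.
Qed.

Lemma is_Cseries_single (w : C) (j : nat) :
  is_Cseries (fun m => if Nat.eqb m j then w else RtoC 0) w.
Proof.
  apply (filterlim_ext_loc (fun _ => w)); [|apply filterlim_const].
  exists j; intros n Hn; symmetry.
  rewrite (sum_n_zero_tail (G := C_R_NormedModule) _ j n Hn).
  - destruct j as [|j]; [now rewrite sum_O|].
    rewrite sum_Sn, (sum_n_ext_loc (G := C_R_NormedModule) _ (fun _ => zero)).
    + rewrite sum_n_const_zero, Nat.eqb_refl; apply (plus_zero_l (G := C_R_NormedModule)).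
    + intros k Hk; destruct (Nat.eqb_spec k (S j)); [lia | reflexivity].
  - intros k Hk; destruct (Nat.eqb_spec k j); [lia | reflexivity].
Qed.

Definition moebius_sum (t : nat -> C) (N : nat) : C :=
  sum_n_m (G := C_R_NormedModule) (fun n => IZR (moebius n) * t n)%C 1 N.

Lemma moebius_sum_0 (t : nat -> C) : moebius_sum t 0 = 0%C.
Proof. apply (sum_n_m_zero (G := C_R_NormedModule)); lia. Qed.

Lemma moebius_sum_succ (t : nat -> C) (N : nat) :
  moebius_sum t (S N) = (moebius_sum t N + IZR (moebius (S N)) * t (S N))%C.
Proof. apply (sum_n_Sm (G := C_R_NormedModule)); lia. Qed.

Lemma moebius_sum_linear (u v : nat -> C) (N : nat) :
  moebius_sum (fun n => 2 * u n - v n)%C N = (2 * moebius_sum u N - moebius_sum v N)%C.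
Proof.
  induction N as [|N IH].
  - rewrite !moebius_sum_0; ring.
  - rewrite !moebius_sum_succ, IH; ring.
Qed.

Lemma moebius_sum_ext (u v : nat -> C) (N : nat) :
  (forall n, (0 < n)%nat -> u n = v n) -> moebius_sum u N = moebius_sum v N.
Proof.
  intros H; induction N as [|N IH]; [now rewrite !moebius_sum_0|].
  rewrite !moebius_sum_succ, IH, H by lia; reflexivity.
Qed.

(** The double sum over [n <= N] and [k], collected according to [m = n k]. *)
Lemma moebius_sum_series (a t : nat -> C) (N : nat) :
  a 0%nat = 0%C ->
  (forall n, (0 < n)%nat -> is_Cseries (fun k => a (k * n)%nat) (t n)) ->
  is_Cseries (fun m => sum_n (divisor_moebius m) N * a m)%C (moebius_sum t N).
Proof.
  intros Ha Ht; induction N as [|N IH].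
  - rewrite moebius_sum_0.
    apply (is_Cseries_ext (fun m => if Nat.eqb m 0 then RtoC 0 else RtoC 0)).
    + intros [|m]; simpl; [rewrite Ha; ring|].
      rewrite sum_O, divisor_moebius_0 by lia; ring.
    + apply is_Cseries_single.
  - rewrite moebius_sum_succ.
    apply (is_Cseries_ext (fun m => sum_n (divisor_moebius m) N * a m +
      IZR (moebius (S N)) * sieve (G := C_R_NormedModule) (S N) a m)%C).
    + intros m; rewrite sum_Sn; change plus with Rplus; rewrite RtoC_plus.
      unfold sieve, divisor_moebius at 3; destruct (divides (S N) m); [ring|].
      change (@zero C_R_NormedModule) with (RtoC 0); ring.
    + apply is_Cseries_plus; [exact IH|].
      apply is_Cseries_scal, is_Cseries_sieve; [lia | apply Ht; lia].
Qed.

(** In [sum_(n <= N) mu(n) sum_k a(n k)] the coefficient of [a m] is the sum of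
    [mu] over the divisors of [m] up to [N]: for [1 <= m <= N] it is 1 if [m = 1]
    and 0 otherwise; for [m > N] it is at most [N] in absolute value, and then
    [N |a m| <= K / (N m^2)], whose sum over [m] is [O(1/N)]. *)
Lemma moebius_inversion (a t : nat -> C) (K : R) :
  a 0%nat = 0%C -> (forall m, Cmod (a m) * INR m ^ 4 <= K) ->
  (forall n, (0 < n)%nat -> is_Cseries (fun k => a (k * n)%nat) (t n)) ->
  filterlim (moebius_sum t) eventually (Clocally (a 1%nat)).
Proof.
  intros Ha HK Ht.
  assert (K0 : 0 <= K) by (generalize (HK 0%nat); simpl; lra).
  set (w := ml_majorant 0 1).
  assert (Hw : ex_series w) by apply ex_series_ml_majorant.
  assert (W0 : 0 <= Series w).
  { apply Rle_trans with (Rabs (Series w)); [apply Rabs_pos|].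
    apply Rabs_Series_le; [|exact Hw].
    intros [|k]; unfold w, ml_majorant; rewrite Rabs_pos_eq; try lra.
    apply Rmult_le_pos; [lra|]; apply Rlt_le, Rinv_0_lt_compat, pow_lt, lt_0_INR; lia. }
  assert (B : forall N, (0 < N)%nat ->
    Cmod (moebius_sum t N - a 1%nat)%C <= 2 * (K * Series w) * / INR N).
  { intros N HN.
    assert (N0 : 0 < INR N) by (apply lt_0_INR, HN).
    set (v := fun m => (sum_n (divisor_moebius m) N * a m +
      (-1)%R * (if Nat.eqb m 1 then a 1%nat else RtoC 0))%C).
    assert (Hv : is_Cseries v (moebius_sum t N + (-1)%R * a 1%nat)%C).
    { apply is_Cseries_plus; [apply moebius_sum_series; assumption|].
      apply is_Cseries_scal, is_Cseries_single. }
    assert (Bv : forall m, Cmod (v m) <= K * / INR N * w m).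
    { intros [|m]; unfold v.
      - replace (Nat.eqb 0 1) with false by reflexivity; rewrite Ha.
        replace (sum_n (divisor_moebius 0) N * 0 + (-1)%R * 0)%C with (RtoC 0) by ring.
        rewrite Cmod_0; simpl; lra.
      - assert (P : 1 <= INR (S m)) by (apply (le_INR 1); lia).
        assert (P2 : 0 < INR (S m) ^ 2) by (apply pow_lt; lra).
        destruct (Nat.le_gt_cases (S m) N) as [L|L].
        + rewrite sum_divisor_moebius by lia.
          replace (Cmod _) with 0.
          * unfold w, ml_majorant; apply Rmult_le_pos.
            -- apply Rmult_le_pos; [exact K0 | apply Rlt_le, Rinv_0_lt_compat, N0].
            -- rewrite Rmult_1_l; apply Rlt_le, Rinv_0_lt_compat, P2.
          * destruct (Nat.eqb_spec (S m) 1) as [E|E].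
            -- rewrite E; replace (_ + _)%C with (RtoC 0) by ring; now rewrite Cmod_0.
            -- replace (_ + _)%C with (RtoC 0) by ring; now rewrite Cmod_0.
        + replace (Nat.eqb (S m) 1) with false by (symmetry; apply Nat.eqb_neq; lia).
          replace (sum_n (divisor_moebius (S m)) N * a (S m) + (-1)%R * 0)%C
            with (sum_n (divisor_moebius (S m)) N * a (S m))%C by ring.
          rewrite Cmod_mult, Cmod_R.
          assert (Q := sum_divisor_moebius_bound (S m) N ltac:(lia)).
          assert (H := HK (S m)).
          assert (LN : INR N <= INR (S m)) by (apply le_INR; lia).
          assert (A0 := Cmod_ge_0 (a (S m))).
          apply Rle_trans with (INR N * Cmod (a (S m))); [apply Rmult_le_compat_r; assumption|].
          unfold w, ml_majorant.
          apply (Rmult_le_reg_r (INR N * INR (S m) ^ 2)); [apply Rmult_lt_0_compat; assumption|].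
          replace (K * / INR N * (1 * / INR (S m) ^ 2) * (INR N * INR (S m) ^ 2)) with K
            by (field; split; lra).
          eapply Rle_trans; [|exact H].
          replace (INR N * Cmod (a (S m)) * (INR N * INR (S m) ^ 2)) with
            (Cmod (a (S m)) * ((INR N) ^ 2 * INR (S m) ^ 2)) by ring.
          apply Rmult_le_compat_l; [exact A0|].
          replace (INR (S m) ^ 4) with (INR (S m) ^ 2 * INR (S m) ^ 2) by ring.
          apply Rmult_le_compat_r; [lra|]; apply pow_incr; lra. }
    assert (Hs : ex_series (fun m => K * / INR N * w m)).
    { apply (ex_series_scal_l (K := R_AbsRing) (V := R_NormedModule)), Hw. }
    replace (moebius_sum t N - a 1%nat)%C with (CSeries v).
    - eapply Rle_trans; [apply (Cmod_CSeries_le v _ Bv Hs)|].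
      rewrite Series_scal_l; apply Req_le; ring.
    - apply (is_Cseries_unique v); [apply (CSeries_correct v _ Bv Hs)|].
      replace (moebius_sum t N - a 1%nat)%C with (moebius_sum t N + (-1)%R * a 1%nat)%C by ring.
      exact Hv. }
  apply filterlim_Cmod; [apply eventually_filter|]; intros e He.
  assert (Hl : is_lim_seq (fun N => 2 * (K * Series w) * / INR N) (2 * (K * Series w) * 0)).
  { apply (is_lim_seq_scal_l (fun N => / INR N) (2 * (K * Series w)) 0).
    change (Finite 0) with (Rbar_inv p_infty).
    apply is_lim_seq_inv; [apply is_lim_seq_INR | discriminate]. }
  rewrite Rmult_0_r in Hl.
  destruct (proj1 (filterlim_locally _ _) Hl (mkposreal e He)) as [N HN].
  exists (S N); intros n Hn.
  eapply Rle_lt_trans; [apply B; lia|].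
  specialize (HN n ltac:(lia)); unfold ball in HN; simpl in HN.
  unfold AbsRing_ball, abs, minus, plus, opp in HN; simpl in HN.
  rewrite Ropp_0, Rplus_0_r in HN; apply Rle_lt_trans with (2 := HN), Rle_abs.
Qed.

(** * The integral against the Mertens function *)

Lemma mertens_succ (n : nat) : mertens (S n) = mertens n + IZR (moebius (S n)).
Proof. apply (sum_n_Sm (G := R_AbelianMonoid)); lia. Qed.

Lemma mertens_0 : mertens 0 = 0.
Proof. apply (sum_n_m_zero (G := R_AbelianMonoid)); lia. Qed.

Lemma mertens_bound (n : nat) : Rabs (mertens n) <= INR n.
Proof.
  induction n as [|n IH]; [rewrite mertens_0, Rabs_R0; simpl; lra|].
  rewrite mertens_succ, S_INR; eapply Rle_trans; [apply Rabs_triang|].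
  apply Rplus_le_compat; [exact IH|].
  rewrite <- abs_IZR; apply IZR_le, MoebiusArithmetic.moebius_bound.
Qed.

(** [M([a / x]) = M(N)] between [N x] and [(N + 1) x]; at the right end it may jump,
    which the integral does not see. *)
Lemma is_RInt_mertens_piece (F F' : R -> C) (x : R) (N : nat) (A B : R) :
  0 < x ->
  (forall a, 0 < a -> is_Cderive F a (F' a) /\ Ccontinuous F' a) ->
  (0 < N)%nat -> INR N * x <= A -> A <= B -> B <= INR (S N) * x ->
  is_RInt (V := C_R_NormedModule) (mertens_integrand x F) A B (mertens N * (F B - F A))%C.
Proof.
  intros x_pos F_C1 HN HA HAB HB.
  assert (N1 : 1 <= INR N) by (apply (le_INR 1); lia).
  assert (A0 : 0 < A) by nra.
  apply (is_RInt_ext (V := C_R_NormedModule) (fun a => mertens N * F' a)%C).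
  { intros a; rewrite Rmin_left, Rmax_right by exact HAB; intros Ha.
    assert (E : Z.of_nat N = Int_part (a / x)).
    { apply Int_part_spec; rewrite <- INR_IZR_INZ, S_INR in *.
      split.
      - apply Rlt_minus_l, (Rmult_lt_reg_r x); [exact x_pos|].
        unfold Rdiv; rewrite Rmult_assoc, Rinv_l by lra; lra.
      - apply (Rmult_le_reg_r x); [exact x_pos|].
        unfold Rdiv; rewrite Rmult_assoc, Rinv_l by lra; lra. }
    unfold mertens_integrand; rewrite <- E, Nat2Z.id.
    rewrite (RC_derive_eq F a (F' a)); [reflexivity|].
    apply F_C1; lra. }
  replace (mertens N * (F B - F A))%C with (mertens N * F B - mertens N * F A)%C by ring.
  apply (is_RInt_derive (V := C_R_CompleteNormedModule) (fun a => mertens N * F a)%C).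
  - intros a; rewrite Rmin_left, Rmax_right by exact HAB; intros Ha.
    apply (is_Cderive_ext (fun a => mertens N * F a)%C); [reflexivity|].
    replace (mertens N * F' a)%C with (0 * F a + mertens N * F' a)%C by ring.
    apply (is_Cderive_mult (fun _ => RtoC (mertens N)) F); [apply is_Cderive_const|].
    apply F_C1; lra.
  - intros a; rewrite Rmin_left, Rmax_right by exact HAB; intros Ha.
    apply (Ccontinuous_mult (fun _ => RtoC (mertens N)) F'); [apply Ccontinuous_const|].
    apply F_C1; lra.
Qed.

(** The integral from [x] to [B], summed by parts; [N] is the integer part of [B / x]. *)
Definition mertens_primitive (F : R -> C) (w : C) (x : R) (N : nat) (B : R) : C :=
  (mertens N * (F B - w) - moebius_sum (fun n => F (INR n * x)%R - w) N)%C.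

Lemma is_RInt_mertens_multiple (F F' : R -> C) (w : C) (x : R) (N : nat) :
  0 < x ->
  (forall a, 0 < a -> is_Cderive F a (F' a) /\ Ccontinuous F' a) ->
  (0 < N)%nat ->
  is_RInt (V := C_R_NormedModule) (mertens_integrand x F) x (INR N * x)
    (mertens_primitive F w x N (INR N * x)).
Proof.
  intros x_pos F_C1; induction N as [|[|N] IH]; intros HN; [lia| |].
  - simpl INR; rewrite Rmult_1_l.
    replace (mertens_primitive F w x 1 x) with (zero : C_R_NormedModule).
    + apply (is_RInt_point (V := C_R_NormedModule)).
    + change (RtoC 0 = mertens_primitive F w x 1 x); unfold mertens_primitive.
      rewrite moebius_sum_succ, moebius_sum_0, mertens_succ, mertens_0, Rplus_0_l.
      simpl INR; rewrite Rmult_1_l; ring.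
  - specialize (IH ltac:(lia)).
    assert (P := is_RInt_mertens_piece F F' x (S N) (INR (S N) * x) (INR (S (S N)) * x) x_pos F_C1
      ltac:(lia) (Rle_refl _) ltac:(rewrite (S_INR (S N)); lra) (Rle_refl _)).
    assert (H := is_RInt_Chasles (V := C_R_NormedModule) _ _ _ _ _ _ IH P).
    replace (mertens_primitive F w x (S (S N)) (INR (S (S N)) * x)) with
      (mertens_primitive F w x (S N) (INR (S N) * x) +
       mertens (S N) * (F (INR (S (S N)) * x)%R - F (INR (S N) * x)%R))%C.
    + exact H.
    + unfold mertens_primitive; rewrite (moebius_sum_succ _ (S N)), (mertens_succ (S N)), RtoC_plus.
      ring.
Qed.

Lemma is_RInt_mertens (F F' : R -> C) (w : C) (x : R) (N : nat) (B : R) :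
  0 < x ->
  (forall a, 0 < a -> is_Cderive F a (F' a) /\ Ccontinuous F' a) ->
  (0 < N)%nat ->
  INR N * x <= B <= INR (S N) * x ->
  is_RInt (V := C_R_NormedModule) (mertens_integrand x F) x B (mertens_primitive F w x N B).
Proof.
  intros x_pos F_C1 HN HB.
  assert (P := is_RInt_mertens_piece F F' x N (INR N * x) B x_pos F_C1 HN (Rle_refl _) (proj1 HB) (proj2 HB)).
  assert (H := is_RInt_Chasles (V := C_R_NormedModule) _ _ _ _ _ _ 
    (is_RInt_mertens_multiple F F' w x N x_pos F_C1 HN) P).
  replace (mertens_primitive F w x N B) with
    (mertens_primitive F w x N (INR N * x) + mertens N * (F B - F (INR N * x)%R))%C.
  - exact H.
  - unfold mertens_primitive; ring.
Qed.

(** The boundary term [M([B / x]) (F B - w)] vanishes at infinity because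
    [|M(N)| <= N] and [F - w] decays. *)
Lemma is_RInt_gen_mertens (F F' : R -> C) (w : C) (x K : R) (L : C) :
  0 < x ->
  (forall a, 0 < a -> is_Cderive F a (F' a) /\ Ccontinuous F' a) ->
  (forall a, 0 < a -> Cmod (F a - w)%C * a ^ 4 <= K) ->
  filterlim (moebius_sum (fun n => F (INR n * x)%R - w)%C) eventually (Clocally L) ->
  is_RInt_gen (V := C_R_NormedModule) (mertens_integrand x F)
    (at_point x) (Rbar_locally p_infty) (- L)%C.
Proof.
  intros x_pos F_C1 HK HL P [e HP].
  assert (e2 : 0 < e / 2) by (generalize (cond_pos e); lra).
  destruct (proj1 (filterlim_Cmod eventually _ _) HL (e / 2) e2) as [N0 HN0].
  set (M := Rmax (Rmax 1 x) (Rmax (INR (S N0) * x) (K / (x * (e / 2))))).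
  apply (Filter_prod _ _ _ (fun a => a = x) (fun B => M < B)); [reflexivity | now exists M |].
  intros a B -> HB; cbn [fst snd].
  assert (M1 : 1 < B /\ x < B /\ INR (S N0) * x < B /\ K / (x * (e / 2)) < B).
  { repeat split; eapply Rle_lt_trans; try exact HB; unfold M.
    - eapply Rle_trans; [apply Rmax_l | apply Rmax_l].
    - eapply Rle_trans; [apply Rmax_r | apply Rmax_l].
    - eapply Rle_trans; [apply Rmax_l | apply Rmax_r].
    - eapply Rle_trans; [apply Rmax_r | apply Rmax_r]. }
  destruct M1 as (B1 & B2 & B3 & B4).
  destruct (nfloor_ex (B / x)) as [N [HN HN']].
  { apply Rlt_le, Rdiv_lt_0_compat; lra. }
  assert (HNB : INR N * x <= B).
  { apply (Rmult_le_compat_r x) in HN; [|lra].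
    unfold Rdiv in HN; rewrite Rmult_assoc, Rinv_l in HN by lra; lra. }
  assert (HNB' : B < INR (S N) * x).
  { apply (Rmult_lt_compat_r x) in HN'; [|lra]; rewrite S_INR.
    unfold Rdiv in HN'; rewrite Rmult_assoc, Rinv_l in HN' by lra; lra. }
  assert (NN : (N0 < N)%nat).
  { assert (INR (S N0) < INR (S N)) by (apply (Rmult_lt_reg_r x); lra).
    apply INR_lt in H; lia. }
  exists (mertens_primitive F w x N B); split; [apply (is_RInt_mertens F F'); auto; [lia | lra]|].
  apply HP, C_NormedModule_mixin_compat1.
  change (Cmod (mertens_primitive F w x N B - - L)%C < e).
  replace (mertens_primitive F w x N B - - L)%C with
    (mertens N * (F B - w) - (moebius_sum (fun n => F (INR n * x)%R - w)%C N - L))%C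
    by (unfold mertens_primitive; ring).
  eapply Rle_lt_trans; [apply Cmod_triangle_minus|].
  specialize (HN0 N ltac:(lia)).
  rewrite Cmod_mult, Cmod_R.
  assert (HM := mertens_bound N); specialize (HK B ltac:(lra)).
  assert (T : Rabs (mertens N) * Cmod (F B - w)%C < e / 2); [|lra].
  apply Rle_lt_trans with (INR N * Cmod (F B - w)%C).
  { apply Rmult_le_compat_r; [apply Cmod_ge_0 | exact HM]. }
  set (c := Cmod (F B - w)%C) in *.
  assert (c0 : 0 <= c) by apply Cmod_ge_0.
  apply (Rmult_lt_reg_r (x * B)); [nra|].
  assert (KB : K < B * (x * (e / 2))).
  { apply (Rmult_lt_compat_r (x * (e / 2))) in B4; [|nra].
    unfold Rdiv at 1 in B4; rewrite Rmult_assoc, Rinv_l in B4 by nra; lra. }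
  apply Rle_lt_trans with (c * B ^ 4); [|lra].
  replace (INR N * c * (x * B)) with (c * ((INR N * x) * B)) by ring.
  apply Rmult_le_compat_l; [exact c0|].
  apply Rle_trans with (B ^ 2); [nra | apply Rle_pow; [lra | lia]].
Qed.

(** * The two identities *)

Lemma ml_sum_tail_series (b logz : C) (a : R) : 0 < a ->
  is_Cseries (fun k => if Nat.eqb k 0 then RtoC 0 else ml_term b logz (a * INR k))
    (ml_sum b logz a - ml_term b logz 0)%C.
Proof.
  intros Ha.
  replace (ml_sum b logz a - ml_term b logz 0)%C with
    (ml_sum b logz a + (-1)%R * ml_term b logz 0)%C by ring.
  apply (is_Cseries_ext (fun k => ml_term b logz (a * INR k) +
    (-1)%R * (if Nat.eqb k 0 then ml_term b logz 0 else RtoC 0))%C).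
  - intros [|k]; cbn [Nat.eqb]; [simpl INR; rewrite Rmult_0_r|]; ring.
  - apply is_Cseries_plus; [apply ml_sum_series, Ha|].
    apply is_Cseries_scal, is_Cseries_single.
Qed.

Lemma ml_sum_tail_decay (b logz : C) :
  exists K, forall a, 0 < a -> Cmod (ml_sum b logz a - ml_term b logz 0)%C * a ^ 4 <= K.
Proof.
  destruct (ml_term_decay b logz) as [K HK].
  exists (2 * (K * Series (ml_majorant 0 1))); intros a Ha.
  assert (a4 : 0 < a ^ 4) by (apply pow_lt, Ha).
  set (u := fun k => if Nat.eqb k 0 then RtoC 0 else ml_term b logz (a * INR k)).
  assert (Hu : forall k, Cmod (u k) <= K * / a ^ 4 * ml_majorant 0 1 k).
  { intros [|k]; unfold u; cbn [Nat.eqb].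
    - rewrite Cmod_0; unfold ml_majorant; lra.
    - eapply Rle_trans; [apply (ml_term_majorant b logz K a (S k) HK Ha)|].
      unfold ml_majorant; lra. }
  assert (Hs : ex_series (fun k => K * / a ^ 4 * ml_majorant 0 1 k)).
  { apply (ex_series_scal_l (K := R_AbsRing) (V := R_NormedModule)), ex_series_ml_majorant. }
  rewrite (is_Cseries_unique u _ _ (ml_sum_tail_series b logz a Ha) (CSeries_correct u _ Hu Hs)).
  assert (H := Cmod_CSeries_le u _ Hu Hs); rewrite Series_scal_l in H.
  apply (Rmult_le_compat_r (a ^ 4)) in H; [|lra].
  eapply Rle_trans; [exact H|]; apply Req_le; field; lra.
Qed.

(** Moebius inversion for [a m = ml_term (x m)], without the constant term [m = 0]. *)
Lemma ml_sum_inversion (b logz : C) (x : R) : 0 < x ->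
  filterlim (moebius_sum (fun n => ml_sum b logz (INR n * x) - ml_term b logz 0)%C)
    eventually (Clocally (ml_term b logz x)).
Proof.
  intros Hx; destruct (ml_term_decay b logz) as [K HK].
  assert (x4 : 0 < x ^ 4) by (apply pow_lt, Hx).
  set (a := fun m => if Nat.eqb m 0 then RtoC 0 else ml_term b logz (x * INR m)).
  replace (ml_term b logz x) with (a 1%nat) by (unfold a; simpl; f_equal; ring).
  apply (moebius_inversion a _ (K * / x ^ 4)); [reflexivity | |].
  - intros [|m]; unfold a; cbn [Nat.eqb].
    + rewrite Cmod_0, Rmult_0_l; apply Rmult_le_pos; [|apply Rlt_le, Rinv_0_lt_compat, x4].
      destruct (HK 0 (Rle_refl 0)) as [H _]; rewrite pow_i, Rmult_0_r in H by lia; exact H.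
    + destruct (HK (x * INR (S m))) as [H _].
      { apply Rmult_le_pos; [lra | apply pos_INR]. }
      rewrite Rpow_mult_distr in H.
      apply (Rmult_le_reg_r (x ^ 4)); [exact x4|].
      rewrite (Rmult_assoc K), Rinv_l by lra; lra.
  - intros n Hn.
    assert (n0 : 0 < INR n) by (apply lt_0_INR, Hn).
    apply (is_Cseries_ext
      (fun k => if Nat.eqb k 0 then RtoC 0 else ml_term b logz (INR n * x * INR k))).
    + intros [|k]; unfold a; [reflexivity|].
      replace (Nat.eqb (S k * n) 0) with false by (symmetry; apply Nat.eqb_neq; lia).
      cbn [Nat.eqb]; f_equal; rewrite mult_INR; ring.
    + apply ml_sum_tail_series; nra.
Qed.

(** The even-index terms of [E_{a,b}(z^a)] sum to [E_{2a,b}(z^{2a})], and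
    [(-1)^k = 2 [k even] - 1]. *)
Lemma mittag_leffler_minus (b logz : C) (a : R) : 0 < a ->
  mittag_leffler a b (- Cpower logz a) = (2 * ml_sum b logz (2 * a) - ml_sum b logz a)%C.
Proof.
  intros Ha; apply mittag_leffler_eq.
  set (u := fun k => ml_term b logz (a * INR k)).
  replace (2 * ml_sum b logz (2 * a) - ml_sum b logz a)%C with
    (2 * ml_sum b logz (2 * a) + (-1)%R * ml_sum b logz a)%C by ring.
  apply (is_Cseries_ext (fun k => 2 * sieve (G := C_R_NormedModule) 2 u k + (-1)%R * u k)%C).
  - intros k.
    replace ((- Cpower logz a) ^ k * recip_Gamma (b + a * INR k))%C with (((-1)%R) ^ k * u k)%C.
    2:{ unfold u, ml_term, Cpower.
        replace (- Cexp (a * logz))%C with ((-1)%R * Cexp (a * logz))%C by ring.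
        rewrite Cpow_mult_l, <- Cexp_pow, RtoC_mult.
        replace (a * INR k * logz)%C with (a * logz * INR k)%C by ring; ring. }
    unfold sieve, divides.
    destruct (Nat.eqb_spec (k mod 2) 0) as [H|H].
    + assert (E : k = (2 * (k / 2))%nat) by (generalize (Nat.div_mod_eq k 2); lia).
      replace ((-1)%R ^ k)%C with (RtoC 1); [ring|].
      rewrite E, Cpow_mult_r. replace ((-1)%R ^ 2)%C with (RtoC 1) by (simpl; ring).
      symmetry; apply Cpow_1_l.
    + assert (E : k = S (2 * (k / 2))).
      { generalize (Nat.div_mod_eq k 2) (Nat.mod_upper_bound k 2 ltac:(lia)); lia. }
      replace ((-1)%R ^ k)%C with (RtoC (-1)).
      * change (@zero C_R_NormedModule) with (RtoC 0); ring.
      * rewrite E, Cpow_S, Cpow_mult_r. replace ((-1)%R ^ 2)%C with (RtoC 1) by (simpl; ring).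
        rewrite Cpow_1_l; ring.
  - apply is_Cseries_plus; apply is_Cseries_scal; [apply is_Cseries_sieve; [lia|]|].
    + apply (is_Cseries_ext (fun k => ml_term b logz (2 * a * INR k))).
      * intros k; unfold u; f_equal; rewrite mult_INR; simpl INR; ring.
      * apply ml_sum_series; lra.
    + exact (ml_sum_series b logz a Ha).
Qed.

Open Scope C_scope.

Theorem mainTheorem7 (b z logz : C) (x : R) :
  z <> 0 -> Cexp logz = z -> (0 < x)%R ->
  let Eplus := fun a : R => mittag_leffler a b (Cpower logz a) in
  let Eminus := fun a : R => mittag_leffler a b (- Cpower logz a) in
  ((forall a : R, (0 < a)%R ->
      ex_derive (K := R_AbsRing) (V := C_R_NormedModule) Eplus a) /\
   ex_RInt_gen (V := C_R_NormedModule)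
     (mertens_integrand x Eplus) (at_point x) (Rbar_locally p_infty) /\
   Cpower logz x * recip_Gamma (b + x) =
   - RInt_gen (V := C_R_CompleteNormedModule)
       (mertens_integrand x Eplus) (at_point x) (Rbar_locally p_infty)) /\
  ((forall a : R, (0 < a)%R ->
      ex_derive (K := R_AbsRing) (V := C_R_NormedModule) Eminus a) /\
   ex_RInt_gen (V := C_R_NormedModule)
     (mertens_integrand x Eminus) (at_point x) (Rbar_locally p_infty) /\
   2 * Cpower logz (2 * x) * recip_Gamma (b + 2 * x) -
   Cpower logz x * recip_Gamma (b + x) =
   - RInt_gen (V := C_R_CompleteNormedModule)
       (mertens_integrand x Eminus) (at_point x) (Rbar_locally p_infty)).
Proof.
  intros _ _ Hx Eplus Eminus.
  set (w := ml_term b logz 0).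
  assert (Ep : forall a, (0 < a)%R -> Eplus a = ml_sum b logz a).
  { intros a Ha; exact (mittag_leffler_plus b logz a Ha). }
  assert (Em : forall a, (0 < a)%R -> Eminus a = 2 * ml_sum b logz (2 * a) - ml_sum b logz a).
  { intros a Ha; exact (mittag_leffler_minus b logz a Ha). }
  clearbody Eplus Eminus.
  assert (C1p : forall a, (0 < a)%R ->
    is_Cderive Eplus a (ml_sum' b logz a) /\ Ccontinuous (ml_sum' b logz) a).
  { intros a Ha; destruct (ml_sum_C1 b logz a Ha) as [D Cn]; split; [|exact Cn].
    apply (is_Cderive_ext_pos (ml_sum b logz) _ a _ Ha); [|exact D].
    intros s Hs; symmetry; apply Ep, Hs. }
  set (dm := fun a : R => 2 * (2 * ml_sum' b logz (2 * a)) + (-1)%R * ml_sum' b logz a).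
  assert (C1m : forall a, (0 < a)%R -> is_Cderive Eminus a (dm a) /\ Ccontinuous dm a).
  { intros a Ha.
    destruct (ml_sum_C1 b logz a Ha) as [D Cn].
    destruct (ml_sum_C1 b logz (2 * a) ltac:(lra)) as [D2 Cn2].
    split.
    - apply (is_Cderive_ext_pos
        (fun a : R => 2 * ml_sum b logz (2 * a) + (-1)%R * ml_sum b logz a) _ a _ Ha).
      { intros s Hs; rewrite (Em s Hs); ring. }
      assert (S : forall (c : R) f l, is_Cderive f a l -> is_Cderive (fun s => c * f s) a (c * l)).
      { intros c f l H; replace (c * l) with (0 * f a + c * l) by ring.
        apply (is_Cderive_mult (fun _ => RtoC c) f); [apply is_Cderive_const | exact H]. }
      apply is_Cderive_plus; apply S; [apply is_Cderive_rescale, D2 | exact D].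
    - apply Ccontinuous_plus; apply Ccontinuous_mult; try apply Ccontinuous_const; [|exact Cn].
      apply Ccontinuous_mult; [apply Ccontinuous_const|].
      apply (continuous_comp (U := R_UniformSpace) (V := R_UniformSpace) (W := C_R_NormedModule)
        (fun s => (2 * s)%R) (ml_sum' b logz)); [|exact Cn2].
      apply (ex_derive_continuous (V := R_NormedModule)); auto_derive; auto. }
  destruct (ml_sum_tail_decay b logz) as [K HK]; fold w in HK.
  assert (Ip : is_RInt_gen (V := C_R_NormedModule) (mertens_integrand x Eplus)
    (at_point x) (Rbar_locally p_infty) (- ml_term b logz x)).
  { apply (is_RInt_gen_mertens Eplus (ml_sum' b logz) w x K _ Hx C1p).
    - intros a Ha; rewrite (Ep a Ha); apply HK, Ha.
    - apply (filterlim_ext (moebius_sum (fun n => ml_sum b logz (INR n * x) - w))).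
      + intros N; apply moebius_sum_ext; intros n Hn; rewrite Ep; [reflexivity|].
        apply Rmult_lt_0_compat; [apply lt_0_INR, Hn | exact Hx].
      + apply ml_sum_inversion, Hx. }
  assert (Im : is_RInt_gen (V := C_R_NormedModule) (mertens_integrand x Eminus)
    (at_point x) (Rbar_locally p_infty)
    (- (2 * ml_term b logz (2 * x) + (-1)%R * ml_term b logz x))).
  (* 3 K bounds 2 (K / 16) + K, from the triangle inequality and the decay of
     the two sums at 2 a and a. *)
  { apply (is_RInt_gen_mertens Eminus dm w x (3 * K) _ Hx C1m).
    - intros a Ha; rewrite (Em a Ha).
      replace (2 * ml_sum b logz (2 * a) - ml_sum b logz a - w) with
        (2 * (ml_sum b logz (2 * a) - w) - (ml_sum b logz a - w)) by ring.
      assert (T := Cmod_triangle_minus (2 * (ml_sum b logz (2 * a) - w)) (ml_sum b logz a - w)).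
      rewrite Cmod_mult, Cmod_R, (Rabs_pos_eq 2) in T by lra.
      assert (H1 := HK a Ha). assert (H2 := HK (2 * a)%R ltac:(lra)).
      rewrite Rpow_mult_distr in H2.
      assert (a4 : (0 < a ^ 4)%R) by (apply pow_lt, Ha).
      generalize (Cmod_ge_0 (ml_sum b logz (2 * a) - w)); nra.
    - apply (filterlim_ext (fun N =>
        2 * moebius_sum (fun n => ml_sum b logz (INR n * (2 * x)) - w) N +
        (-1)%R * moebius_sum (fun n => ml_sum b logz (INR n * x) - w) N)).
      + intros N.
        transitivity (moebius_sum (fun n => 2 * (ml_sum b logz (INR n * (2 * x)) - w) -
          (ml_sum b logz (INR n * x) - w)) N).
        { rewrite moebius_sum_linear; ring. }
        apply moebius_sum_ext; intros n Hn.
        assert (0 < INR n)%R by (apply lt_0_INR, Hn).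
        rewrite Em by nra.
        replace (2 * (INR n * x))%R with (INR n * (2 * x))%R by ring; ring.
      + apply filterlim_Cplus; [apply eventually_filter | |];
          (apply filterlim_Cmult; [apply eventually_filter | apply filterlim_const |]);
          apply ml_sum_inversion; lra. }
  split; (split; [|split]).
  - intros a Ha; eexists; apply C1p, Ha.
  - eexists; exact Ip.
  - rewrite (is_RInt_gen_unique (V := C_R_CompleteNormedModule) _ _ Ip).
    unfold ml_term, Cpower; ring.
  - intros a Ha; eexists; apply C1m, Ha.
  - eexists; exact Im.
  - rewrite (is_RInt_gen_unique (V := C_R_CompleteNormedModule) _ _ Im).
    unfold ml_term, Cpower; rewrite RtoC_mult; ring.
Qed.
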